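(* Let $\mathscr A:(\Omega,\mathscr F,\mathbb P)\to\mathbb R^{n\times n}$ be a random covariance matrix with $\mathbb E\|\mathscr A\|_1<+\infty$. A random matrix-valued kernel $\mathscr A^\times\in\mathcal K^\times(\mathscr A)$ satisfies $$\mathscr A^\times\in\operatorname*{arg\,max}_{\mathscr B^\times\in\mathcal K^\times(\mathscr A)}\big\|\widehat{\mathscr B^\times}\big\|_1$$ if and only if $$\int_\Omega\mathscr A^\times(\omega,\omega')\,d\mathbb P(\omega')=\int_\Omega\mathscr G(\omega)\mathscr G(\omega')^*\,d\mathbb P(\omega')\in\mathbb R^{n\times n}\qquad\mathbb P\text{-a.s. (in }\omega)$$ for some optimal random Green's matrix $\mathscr G\in\mathcal G(\mathscr A)$. Consequently, if an optimal random Green's matrix does not exist, neither does a barycenter of $\mathscr A$. If an optimal random Green's matrix $\mathscr G$ exists, then $\mathscr A^\times(\omega,\omega')=\mathscr G(\omega)\mathscr G(\omega')^*$ is an optimal random kernel, i.e. attains the maximum.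
   Context: $\|\cdot\|_1$ and $\|\cdot\|_2$ are the trace (nuclear) norm and Hilbert–Schmidt norm; $^*$ is the transpose. A random covariance matrix is a random matrix with $\mathscr A(\omega)$ symmetric positive semidefinite (s.p.d.) for every $\omega$. A random Green's matrix $\mathscr G\in\mathcal G(\mathscr A)$ is a random matrix with $\mathscr G(\omega)\mathscr G(\omega)^*=\mathscr A(\omega)$ $\mathbb P$-a.s.; it is optimal if $\|\mathbb E\mathscr G\|_2=\max_{\mathscr S\in\mathcal G(\mathscr A)}\|\mathbb E\mathscr S\|_2$. A barycenter of $\mathscr A$ is an s.p.d. minimizer $\hat{\mathbf A}$ of $\mathbf B\mapsto\mathbb E\,\mathcal W_2^2(\mathbf B,\mathscr A)$ over s.p.d. $\mathbf B$, where $\mathcal W_2^2(\mathbf A,\mathbf B)=\operatorname{tr}\mathbf A+\operatorname{tr}\mathbf B-2\operatorname{tr}(\mathbf A^{1/2}\mathbf B\mathbf A^{1/2})^{1/2}$. $\mathcal K^\times(\mathscr A)$ is the set of random matrix-valued kernels for $\mathscr A$: measurable functions $\mathscr A^\times:\Omega\times\Omega\to\mathbb R^{n\times n}$ such that (i) $\mathscr A^\times(\omega,\omega)=\mathscr A(\omega)$ for all $\omega$; (ii) $\mathscr A^\times(\omega,\omega')=\mathscr A^\times(\omega',\omega)^*$ for all $\omega,\omega'$; (iii) $\sum_{i,j=1}^m\langle\mathbf v_i,\mathscr A^\times(\omega_i,\omega_j)\mathbf v_j\rangle\ge0$ for all $m$, $\omega_1,\dots,\omega_m\in\Omega$ and $\mathbf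 v_1,\dots,\mathbf v_m\in\mathbb R^n$. For such a kernel, $\widehat{\mathscr A^\times}:=\int_{\Omega\times\Omega}\mathscr A^\times(\omega,\omega')\,d\mathbb P(\omega)\,d\mathbb P(\omega')\succeq\mathbf 0$.
   Formalization: In the last claim, since GG*=A holds only a.s. while kernels need the diagonal to equal A everywhere, G is replaced by an optimal random Green's matrix G' equal to G wherever GG*=A, and G'(ω)G'(ω')* is the optimal kernel. *)

(* Defs.v *)
From HB Require Import structures.
From mathcomp Require Import all_boot all_order all_algebra.
From mathcomp Require Import all_classical all_reals all_analysis.

Set Implicit Arguments.
Unset Strict Implicit.
Unset Printing Implicit Defensive.

Import Order.TTheory GRing.Theory Num.Theory.
Import numFieldNormedType.Exports.

Local Open Scope classical_set_scope.
Local Open Scope ring_scope.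

Section Matrices.
Context {R : realType} {n : nat}.
Implicit Types A B M : 'M[R]_n.

Definition spd_mx M : Prop :=
  M^T = M /\ forall v : 'cV[R]_n, 0 <= (v^T *m M *m v) 0 0.

(* The s.p.d. square root, which exists and is unique when M is s.p.d.;
   only ever applied to s.p.d. matrices below. *)
Definition sqrt_mx M : 'M[R]_n := xget 0 [set S | spd_mx S /\ S *m S = M].

Definition trace_norm M : R := \tr (sqrt_mx (M^T *m M)).

Definition hs_norm M : R := Num.sqrt (\tr (M^T *m M)).

Definition wasserstein2 A B : R :=
  \tr A + \tr B - 2 * \tr (sqrt_mx (sqrt_mx A *m B *m sqrt_mx A)).

End Matrices.

(* Entrywise measurability is Borel measurability, as 'M[R]_n is R^(n*n). *)
Definition measurable_mx {R : realType} {n : nat} {d : measure_display}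
    {T : measurableType d} (F : T -> 'M[R]_n) : Prop :=
  forall i j, measurable_fun [set: T] (fun x => F x i j).

(* Entrywise integral. Rintegral is 0 on an infinite or undefined integral, but
   all the integrals taken below converge absolutely when 'E_P[tr A] is finite:
   |K (w, w') i j|^2 <= A w i i * A w' j j for a kernel K for A, and
   |G w i j|^2 <= tr (A w) almost surely for a Green's matrix G of A. *)
Definition mx_integral {R : realType} {n : nat} {d : measure_display}
    {T : measurableType d} (mu : {measure set T -> \bar R})
    (F : T -> 'M[R]_n) : 'M[R]_n :=
  \matrix_(i, j) \int[mu]_x (F x i j).

Section RandomMatrices.
Context {R : realType} {n : nat} {d : measure_display} {T : measurableType d}.
Variable P : probability T R.
Implicit Types (A G : T -> 'M[R]_n) (K : T * T -> 'M[R]_n).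

Definition random_covariance A : Prop :=
  measurable_mx A /\ forall w, spd_mx (A w).

Definition random_green A G : Prop :=
  measurable_mx G /\ {ae P, forall w, G w *m (G w)^T = A w}.

Definition optimal_green A G : Prop :=
  random_green A G /\
  forall S, random_green A S ->
    hs_norm (mx_integral P S) <= hs_norm (mx_integral P G).

Definition barycenter A (B : 'M[R]_n) : Prop :=
  spd_mx B /\
  forall C, spd_mx C ->
    ('E_P[fun w => wasserstein2 B (A w)] <=
     'E_P[fun w => wasserstein2 C (A w)])%E.

Definition random_kernel A K : Prop :=
  [/\ measurable_mx K,
      forall w, K (w, w) = A w,
      forall w w', K (w, w') = (K (w', w))^T &
      forall (m : nat) (w : 'I_m -> T) (v : 'I_m -> 'cV[R]_n),
        0 <= \sum_(i < m) \sum_(j < m)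
               ((v i)^T *m K (w i, w j) *m v j) 0 0].

Definition kernel_hat K : 'M[R]_n := mx_integral (P \x P)%E K.

Definition optimal_kernel A K : Prop :=
  random_kernel A K /\
  forall L, random_kernel A L ->
    trace_norm (kernel_hat L) <= trace_norm (kernel_hat K).

(* For a Green's matrix G of A this is a kernel for A only up to a null set:
   G w *m (G w)^T = A w holds almost surely, whereas random_kernel asks for the
   diagonal to be A w at every w. Where that matters, G is first corrected on
   the null set of points w at which the factorization fails. *)
Definition green_kernel G : T * T -> 'M[R]_n :=
  fun z => G z.1 *m (G z.2)^T.

End RandomMatrices.

(* Main.v *)
(* Write M for the mean of a kernel K of A and D = M^(1/2). The trace norm of M
   is the squared Hilbert-Schmidt norm of D, and D is the mean of
   G0(w) = E_w' K(w, w') M^(-1/2), which satisfies G0 G0^T <= A. Conversely each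
   G with G G^T <= A gives the kernel G(w) G(w')^T + H(w) H(w')^T with
   H = (A - G G^T)^(1/2), whose mean has trace at least |E G|^2. So kernels
   compete on the relaxed constraint G G^T <= A.
   The relaxation does not raise the supremum: for invertible s.p.d. D,
   S = D^-1 (D A D)^(1/2) satisfies S S^T = A and maximizes <D, S>, and
   maximizing |E G|^2 amounts to maximizing the functionals <D, E G>.
   If K is optimal, tilting G0 towards the defect Q = A - G0 G0^T would raise
   <D, E G0> to first order unless Q D = 0 almost surely; then G0 + Q^(1/2) is
   an optimal Green's matrix with the prescribed sections.
   For a barycenter B and D = B^(1/2), the maximizer A D ((D A D)^(1/2))^+ of
   <D, G> under G G^T <= A yields an optimal kernel, since the objective at B is
   tr E A + |D|^2 - 2 E tr (D A D)^(1/2). *)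
Require Import Defs.
From mathcomp Require Import all_boot all_order all_algebra.
From mathcomp Require Import all_classical all_reals all_analysis.
From mathcomp Require Import measurable_realfun ring lra.
Import Order.TTheory GRing.Theory Num.Theory.
Import numFieldNormedType.Exports.
Set Implicit Arguments.
Unset Strict Implicit.
Unset Printing Implicit Defensive.
Local Open Scope classical_set_scope.
Local Open Scope ring_scope.

(** * Positive semidefinite matrices and the Hilbert-Schmidt inner product *)

Section PositiveSemidefinite.
Context {R : realType} {n : nat}.
Implicit Types (A B M N X Y : 'M[R]_n) (u v : 'cV[R]_n).

Definition qform M u v : R := (u^T *m M *m v) 0 0.

Lemma qformDm M N u v : qform (M + N) u v = qform M u v + qform N u v.
Proof. by rewrite /qform mulmxDr mulmxDl mxE. Qed.

Lemma qformZm a M u v : qform (a *: M) u v = a * qform M u v.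
Proof. by rewrite /qform -scalemxAr -scalemxAl mxE. Qed.

Lemma qformBm M N u v : qform (M - N) u v = qform M u v - qform N u v.
Proof. by rewrite /qform mulmxBr mulmxBl !mxE. Qed.

Lemma qformDl M u1 u2 v : qform M (u1 + u2) v = qform M u1 v + qform M u2 v.
Proof. by rewrite /qform linearD !mulmxDl mxE. Qed.

Lemma qformDr M u v1 v2 : qform M u (v1 + v2) = qform M u v1 + qform M u v2.
Proof. by rewrite /qform mulmxDr mxE. Qed.

Lemma qformZl M a u v : qform M (a *: u) v = a * qform M u v.
Proof. by rewrite /qform linearZ -!scalemxAl mxE. Qed.

Lemma qformZr M a u v : qform M u (a *: v) = a * qform M u v.
Proof. by rewrite /qform -scalemxAr mxE. Qed.

Lemma qform_tr M u v : qform M^T u v = qform M v u.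
Proof.
rewrite /qform -[in RHS](trmxK (v^T *m M *m u)) [RHS]mxE.
by rewrite !trmx_mul trmxK mulmxA.
Qed.

Lemma qform_conj M X u v : qform (X^T *m M *m X) u v = qform M (X *m u) (X *m v).
Proof. by rewrite /qform trmx_mul !mulmxA. Qed.

Lemma qform_mul M X u v : qform (M *m X) u v = qform M u (X *m v).
Proof. by rewrite /qform !mulmxA. Qed.

Lemma qform_delta M i j : qform M (delta_mx i 0) (delta_mx j 0) = M i j.
Proof. by rewrite /qform trmx_delta -rowE -colE !mxE. Qed.

Lemma qform1_ge0 v : 0 <= qform 1%:M v v.
Proof.
rewrite /qform mulmx1 mxE; apply: sumr_ge0 => i _.
by rewrite mxE -expr2 sqr_ge0.
Qed.

Lemma spd_sym M : spd_mx M -> M^T = M. Proof. by case. Qed.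

Lemma spd_qform M v : spd_mx M -> 0 <= qform M v v. Proof. by case=> _; exact. Qed.

Lemma spd0 : spd_mx (0 : 'M[R]_n).
Proof. by split=> [|v]; [rewrite trmx0 | rewrite mulmx0 mul0mx mxE]. Qed.

Lemma spd1 : spd_mx (1%:M : 'M[R]_n).
Proof. by split=> [|v]; [rewrite trmx1 | exact: qform1_ge0]. Qed.

Lemma spdD M N : spd_mx M -> spd_mx N -> spd_mx (M + N).
Proof.
move=> [sM pM] [sN pN]; split=> [|v]; first by rewrite linearD /= sM sN.
by rewrite -/(qform _ _ _) qformDm addr_ge0// -?/(qform _ _ _) ?pM ?pN.
Qed.

Lemma spdZ a M : 0 <= a -> spd_mx M -> spd_mx (a *: M).
Proof.
move=> a0 [sM pM]; split=> [|v]; first by rewrite linearZ /= sM.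
by rewrite -/(qform _ _ _) qformZm mulr_ge0// pM.
Qed.

Lemma spd_conj M X : spd_mx M -> spd_mx (X^T *m M *m X).
Proof.
move=> [sM pM]; split=> [|v]; first by rewrite !trmx_mul trmxK sM mulmxA.
by rewrite -/(qform _ _ _) qform_conj pM.
Qed.

Lemma spd_conjT M X : spd_mx M -> spd_mx (X *m M *m X^T).
Proof. by move=> /(@spd_conj _ X^T); rewrite trmxK. Qed.

Lemma spd_conj_sym M X : X^T = X -> spd_mx M -> spd_mx (X *m M *m X).
Proof. by move=> sX /(@spd_conj _ X); rewrite sX. Qed.

Lemma spd_gram X : spd_mx (X *m X^T).
Proof. by have /(@spd_conjT _ X) := spd1; rewrite mulmx1. Qed.

Lemma spd_mulss M : spd_mx M -> spd_mx (M *m M).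
Proof. by move=> [sM _]; rewrite -{2}sM; exact: spd_gram. Qed.

Lemma spd_diag_ge0 M i : spd_mx M -> 0 <= M i i.
Proof. by move=> pM; rewrite -qform_delta spd_qform. Qed.

Lemma spd_tr_ge0 M : spd_mx M -> 0 <= \tr M.
Proof. by move=> pM; apply: sumr_ge0 => i _; exact: spd_diag_ge0. Qed.

Lemma spd_le_tr M i : spd_mx M -> M i i <= \tr M.
Proof.
move=> pM; rewrite /mxtrace (bigD1 i)//= lerDl.
by apply: sumr_ge0 => j _; exact: spd_diag_ge0.
Qed.

(** The quadratic form is nonnegative at e_i + e_j and at e_i - e_j, which bounds the entry on both
    sides. *)
Lemma spd_normE M i j : spd_mx M -> `|M i j| <= (M i i + M j j) / 2.
Proof.
move=> pM; have sM : M j i = M i j by rewrite -[in LHS](spd_sym pM) mxE.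
have := spd_qform (delta_mx i 0 + delta_mx j 0) pM.
have := spd_qform (delta_mx i 0 + (-1) *: delta_mx j 0) pM.
rewrite !(qformDl, qformDr, qformZl, qformZr, qform_delta) sM => h1 h2.
by rewrite ler_norml; apply/andP; split; lra.
Qed.

Lemma spd_norm_le_tr M i j : spd_mx M -> `|M i j| <= \tr M.
Proof.
move=> pM; have := spd_normE i j pM; have := spd_le_tr i pM.
by have := spd_le_tr j pM; lra.
Qed.

Lemma spd_tr_eq0 M : spd_mx M -> \tr M = 0 -> M = 0.
Proof.
move=> pM trM; apply/matrixP => i j; rewrite mxE; apply/eqP.
by rewrite -normr_le0 -trM spd_norm_le_tr.
Qed.

(** The Hilbert-Schmidt inner product, written <X, Y> below, with |X| for its norm. *)
Definition frob X Y : R := \tr (X^T *m Y).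

Lemma frobC X Y : frob X Y = frob Y X.
Proof. by rewrite /frob -mxtrace_tr trmx_mul trmxK. Qed.

Lemma frobDl X Y M : frob (X + Y) M = frob X M + frob Y M.
Proof. by rewrite /frob linearD mulmxDl mxtraceD. Qed.

Lemma frobDr X Y M : frob M (X + Y) = frob M X + frob M Y.
Proof. by rewrite !(frobC M) frobDl. Qed.

Lemma frobZl a X Y : frob (a *: X) Y = a * frob X Y.
Proof. by rewrite /frob linearZ -scalemxAl mxtraceZ. Qed.

Lemma frobZr a X Y : frob X (a *: Y) = a * frob X Y.
Proof. by rewrite !(frobC X) frobZl. Qed.

Lemma frobE X Y : frob X Y = \sum_i \sum_j X i j * Y i j.
Proof.
rewrite /frob /mxtrace exchange_big /=; apply: eq_bigr => j _.
by rewrite mxE; apply: eq_bigr => i _; rewrite mxE.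
Qed.

Lemma frob_trE X Y : frob X Y = \tr (X *m Y^T).
Proof. by rewrite frobC /frob mxtrace_mulC. Qed.

Lemma frob_ge0 X : 0 <= frob X X.
Proof. by rewrite frob_trE; apply/spd_tr_ge0/spd_gram. Qed.

Lemma sqr_le_frob X i j : X i j ^+ 2 <= frob X X.
Proof.
rewrite frobE (bigD1 i)//= (bigD1 j)//= -expr2 -addrA lerDl addr_ge0//.
  by apply: sumr_ge0 => k _; rewrite -expr2 sqr_ge0.
by apply: sumr_ge0 => k _; apply: sumr_ge0 => l _; rewrite -expr2 sqr_ge0.
Qed.

Lemma frob_eq0 X : frob X X = 0 -> X = 0.
Proof.
move=> X0; apply/matrixP => i j; rewrite mxE; apply/eqP.
by rewrite -sqrf_eq0 eq_le sqr_ge0 -X0 sqr_le_frob.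
Qed.

Lemma gram_eq0 X : X *m X^T = 0 -> X = 0.
Proof. by move=> X0; apply: frob_eq0; rewrite frob_trE X0 mxtrace0. Qed.

Lemma frob_amgm X Y : 2 * frob X Y <= frob X X + frob Y Y.
Proof.
have := frob_ge0 (X + (-1) *: Y).
by rewrite !(frobDl, frobDr, frobZl, frobZr) (frobC Y X); lra.
Qed.

(** Put X = M - N and Z = M + N. Equal squares give Z X = - X Z, so X Z X has trace zero, which
    forces the s.p.d. matrices X M X and X N X to vanish. Subtracting gives X^3 = 0, and X = 0 since
    X is symmetric. *)
Lemma spd_sqrt_unique M N : spd_mx M -> spd_mx N -> M *m M = N *m N -> M = N.
Proof.
move=> pM pN eqMN; pose X := M - N; pose Z := M + N.
have sX : X^T = X by rewrite linearB /= (spd_sym pM) (spd_sym pN).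
have ZX : Z *m X + X *m Z = 0.
  rewrite /X /Z !(mulmxDl, mulmxBl, mulmxDr, mulmxBr, mulNmx, mulmxN) eqMN.
  by apply/matrixP => i j; rewrite !mxE; ring.
have tr0 : \tr (X *m M *m X) + \tr (X *m N *m X) = 0.
  have trE : \tr (X *m Z *m X) = - \tr (X *m Z *m X).
    rewrite {1}mxtrace_mulC -mulmxA (_ : X *m Z = - (Z *m X)).
      by rewrite mulmxN linearN /= mulmxA mxtrace_mulC mulmxA.
    by apply/eqP; rewrite -addr_eq0 addrC ZX.
  by rewrite -mxtraceD -mulmxDl -mulmxDr -/Z; lra.
have pXM := spd_conj_sym sX pM; have pXN := spd_conj_sym sX pN.
have trM : \tr (X *m M *m X) = 0.
  by have := spd_tr_ge0 pXM; have := spd_tr_ge0 pXN; lra.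
have trN : \tr (X *m N *m X) = 0 by lra.
have X3 : X *m X *m X = 0.
  have <- : X *m M *m X - X *m N *m X = X *m X *m X.
    by rewrite -mulmxBl -mulmxBr.
  by rewrite (spd_tr_eq0 pXM)// (spd_tr_eq0 pXN)// subrr.
have X2 : X *m X = 0.
  by apply: gram_eq0; rewrite trmx_mul sX mulmxA X3 mul0mx.
by apply/eqP; rewrite -subr_eq0; apply/eqP/gram_eq0; rewrite -/X sX.
Qed.

End PositiveSemidefinite.

(** * Entrywise limits of matrices *)

Section EntrywiseLimit.
Context {R : realType}.

Definition mx_cvg m p (F : nat -> 'M[R]_(m, p)) (L : 'M[R]_(m, p)) : Prop :=
  forall i j, F k i j @[k --> \oo] --> L i j.

Lemma mx_cvg_cst m p (L : 'M[R]_(m, p)) : mx_cvg (fun=> L) L.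
Proof. by move=> i j; exact: cvg_cst. Qed.

Lemma mx_cvgD m p (F G : nat -> 'M[R]_(m, p)) L M :
  mx_cvg F L -> mx_cvg G M -> mx_cvg (fun k => F k + G k) (L + M).
Proof.
move=> FL GM i j; under eq_fun do rewrite mxE; rewrite mxE.
exact: cvgD (FL i j) (GM i j).
Qed.

Lemma mx_cvgB m p (F G : nat -> 'M[R]_(m, p)) L M :
  mx_cvg F L -> mx_cvg G M -> mx_cvg (fun k => F k - G k) (L - M).
Proof.
move=> FL GM i j; under eq_fun do rewrite !mxE; rewrite !mxE.
exact: cvgB (FL i j) (GM i j).
Qed.

Lemma mx_cvgZ m p a (F : nat -> 'M[R]_(m, p)) L :
  mx_cvg F L -> mx_cvg (fun k => a *: F k) (a *: L).
Proof.
move=> FL i j; under eq_fun do rewrite mxE; rewrite mxE.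
by apply: cvgM; [exact: cvg_cst | exact: FL].
Qed.

Lemma mx_cvgM m p q (F : nat -> 'M[R]_(m, p)) (G : nat -> 'M[R]_(p, q)) L M :
  mx_cvg F L -> mx_cvg G M -> mx_cvg (fun k => F k *m G k) (L *m M).
Proof.
move=> FL GM i j; under eq_fun do rewrite mxE; rewrite mxE.
apply: cvg_big => [|l _]; last by apply: cvgM; [exact: FL | exact: GM].
by apply: @add_continuous.
Qed.

Lemma mx_cvg_unique m p (F : nat -> 'M[R]_(m, p)) L M :
  mx_cvg F L -> mx_cvg F M -> L = M.
Proof.
by move=> FL FM; apply/matrixP => i j; exact: cvg_unique (FL i j) (FM i j).
Qed.

Lemma mx_cvg_spd n (F : nat -> 'M[R]_n) L :
  (forall k, spd_mx (F k)) -> mx_cvg F L -> spd_mx L.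
Proof.
move=> pF FL; split.
  apply/matrixP => i j; rewrite mxE; apply: cvg_unique (FL j i) _ => //.
  rewrite (_ : (fun k => F k j i) = fun k => F k i j); first exact: FL.
  by apply/funext => k; rewrite -[in LHS](spd_sym (pF k)) mxE.
move=> v; pose q := mx_cvgM (mx_cvgM (@mx_cvg_cst _ _ v^T) FL) (@mx_cvg_cst _ _ v).
rewrite -(cvg_lim _ (q 0 0))//; apply: limr_ge; first by apply: cvgP (q 0 0).
by apply: nearW => k; exact: (pF k).2.
Qed.

End EntrywiseLimit.

(** * Existence of the square root as an explicit limit *)

Section SquareRoot.
Context {R : realType} {n : nat}.
Implicit Types (B M N S X Y : 'M[R]_n).

(* Polynomials in [B] with nonnegative coefficients. They are closed under
   products, whereas the product of s.p.d. matrices need not be s.p.d. *)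
Inductive pos_poly B : 'M[R]_n -> Prop :=
| pos_poly_exp k : pos_poly B (B ^+ k)
| pos_polyD X Y : pos_poly B X -> pos_poly B Y -> pos_poly B (X + Y)
| pos_polyZ a X : 0 <= a -> pos_poly B X -> pos_poly B (a *: X).

Lemma pos_polyM B X Y : pos_poly B X -> pos_poly B Y -> pos_poly B (X *m Y).
Proof.
elim=> [k|X1 X2 _ IH1 _ IH2|a X1 a0 _ IH] pY.
- elim: pY => [l|Y1 Y2 _ IH1 _ IH2|a Y1 a0 _ IH].
  + by rewrite mulmxE -exprD; exact: pos_poly_exp.
  + by rewrite mulmxDr; exact: pos_polyD.
  + by rewrite -scalemxAr; exact: pos_polyZ.
- by rewrite mulmxDl; exact: pos_polyD (IH1 pY) (IH2 pY).
- by rewrite -scalemxAl; exact: pos_polyZ a0 (IH pY).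
Qed.

Lemma spd_exp B k : spd_mx B -> spd_mx (B ^+ k).
Proof.
move=> pB; have [m] := ubnP k; elim: m k => // m IH [|[|k]] km.
- by rewrite expr0; exact: spd1.
- by rewrite expr1.
- rewrite exprS exprSr mulrA; apply: spd_conj_sym (spd_sym pB) (IH _ _).
  by move: km; rewrite !ltnS => /ltnW.
Qed.

Lemma pos_poly_spd B X : spd_mx B -> pos_poly B X -> spd_mx X.
Proof.
move=> pB; elim=> [k|X1 X2 _ p1 _ p2|a X1 a0 _ p1].
- exact: spd_exp.
- exact: spdD.
- exact: spdZ.
Qed.

(* Iterates of [Y = (B + Y^2) / 2], whose least solution is [1 - sqrt (1 - B)]. *)
Fixpoint sqrt_iter B k : 'M[R]_n :=
  if k is k'.+1 then 2^-1 *: (B + sqrt_iter B k' *m sqrt_iter B k') else 0.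

(** For consecutive iterates Y and Z the next difference is (Z^2 - Y^2) / 2, and expanding it in Y
    and Z - Y leaves no negative coefficient; so both claims go through in one induction. *)
Lemma sqrt_iter_pos B k : pos_poly B (sqrt_iter B k) /\
  pos_poly B (sqrt_iter B k.+1 - sqrt_iter B k).
Proof.
have h0 : 0 <= 2^-1 :> R by rewrite invr_ge0.
elim: k => [|k [IH1 IH2]].
  rewrite /= mul0mx addr0 subr0; split.
    by rewrite -(scale0r (B ^+ 0)); apply: pos_polyZ => //; exact: pos_poly_exp.
  by apply: pos_polyZ => //; exact: (pos_poly_exp B 1).
split.
  apply: pos_polyZ => //; apply: pos_polyD; first exact: (pos_poly_exp B 1).
  exact: pos_polyM.
set Y := sqrt_iter B k in IH1 IH2 *; set Z := sqrt_iter B k.+1 in IH2 *.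
have -> : sqrt_iter B k.+2 - Z =
    2^-1 *: (Y *m (Z - Y) + (Z - Y) *m Y + (Z - Y) *m (Z - Y)).
  rewrite -[sqrt_iter B k.+2]/(2^-1 *: (B + Z *m Z)).
  rewrite -[X in _ - X]/(2^-1 *: (B + Y *m Y)) -scalerBr; congr (_ *: _).
  rewrite !(mulmxBl, mulmxBr); apply/matrixP => i j; rewrite !mxE; ring.
apply: pos_polyZ => //; apply: pos_polyD; last exact: pos_polyM.
by apply: pos_polyD; exact: pos_polyM.
Qed.

Lemma spd_sub_sqr Y : spd_mx Y -> spd_mx (1%:M - Y) -> spd_mx (Y - Y *m Y).
Proof.
move=> pY pZ.
have -> : Y - Y *m Y =
    Y *m (1%:M - Y) *m Y + (1%:M - Y) *m Y *m (1%:M - Y).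
  rewrite !(mulmxBl, mulmxBr, mul1mx, mulmx1).
  by apply/matrixP => i j; rewrite !mxE; ring.
by apply: spdD; apply: spd_conj_sym => //; apply: spd_sym.
Qed.

Lemma sqrt_iter_le1 B k : spd_mx B -> spd_mx (1%:M - B) ->
  spd_mx (1%:M - sqrt_iter B k).
Proof.
move=> pB pB1; elim: k => [|k IH]; first by rewrite subr0; exact: spd1.
rewrite /=; set Y := sqrt_iter B k in IH *.
have pY : spd_mx Y by apply: pos_poly_spd pB (sqrt_iter_pos B k).1.
have -> : 1%:M - 2^-1 *: (B + Y *m Y) =
    2^-1 *: ((1%:M - B) + ((1%:M - Y) + (Y - Y *m Y))).
  by apply/matrixP => i j; rewrite !mxE; lra.
apply: spdZ; first by rewrite invr_ge0.
by apply: spdD => //; apply: spdD => //; exact: spd_sub_sqr.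
Qed.

(** Along each vector the quadratic forms of the iterates increase and stay below that of 1, so they
    converge; polarization recovers the entries. *)
Lemma sqrt_iter_cvg B : spd_mx B -> spd_mx (1%:M - B) ->
  exists2 Y, mx_cvg (sqrt_iter B) Y & spd_mx (1%:M - Y).
Proof.
move=> pB pB1; pose q v k := qform (sqrt_iter B k) v v.
have cq v : cvgn (q v).
  apply: nondecreasing_is_cvgn.
    apply/nondecreasing_seqP => k; rewrite -subr_ge0 -qformBm.
    by apply/spd_qform/(pos_poly_spd pB)/(sqrt_iter_pos B k).2.
  exists (qform 1%:M v v) => _ [k _ <-]; rewrite -subr_ge0 -qformBm.
  by apply/spd_qform/sqrt_iter_le1.
pose e i : 'cV[R]_n := delta_mx i 0.
have qE k i j : sqrt_iter B k i j =
    2^-1 * (q (e i + e j) k - q (e i) k - q (e j) k).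
  have sY : sqrt_iter B k j i = sqrt_iter B k i j.
    by rewrite -[in LHS](spd_sym (pos_poly_spd pB (sqrt_iter_pos B k).1)) mxE.
  by rewrite /q !(qformDl, qformDr) !qform_delta sY; field.
pose Y := \matrix_(i, j)
  (2^-1 * (limn (q (e i + e j)) - limn (q (e i)) - limn (q (e j)))).
have cY : mx_cvg (sqrt_iter B) Y.
  move=> i j; rewrite mxE; under eq_fun do rewrite qE.
  apply: cvgM; first exact: cvg_cst.
  by apply: cvgB; [apply: cvgB|]; exact: cq.
exists Y => //; apply: (@mx_cvg_spd _ _ (fun k => 1%:M - sqrt_iter B k)).
  by move=> k; exact: sqrt_iter_le1.
exact: mx_cvgB (@mx_cvg_cst _ _ _ 1%:M) cY.
Qed.

(** A crude bound of the top eigenvalue, from |M_ij| <= tr M and 2 |v_i v_j| <= v_i^2 + v_j^2. *)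
Lemma spd_sub_scalar M : spd_mx M -> spd_mx ((n%:R * \tr M)%:M - M).
Proof.
move=> pM; split=> [|v]; first by rewrite linearB /= tr_scalar_mx (spd_sym pM).
rewrite -/(qform _ _ _) qformBm subr_ge0 -[(_ * _)%:M]mulmx1 mul_scalar_mx.
rewrite qformZm /qform.
have -> : (v^T *m M *m v) 0 0 = \sum_i \sum_j v j 0 * M j i * v i 0.
  rewrite mxE; apply: eq_bigr => i _; rewrite mxE mulr_suml.
  by apply: eq_bigr => j _; rewrite mxE.
have -> : (v^T *m 1%:M *m v) 0 0 = \sum_i v i 0 ^+ 2.
  by rewrite mulmx1 mxE; apply: eq_bigr => i _; rewrite mxE.
have -> : n%:R * \tr M * (\sum_i v i 0 ^+ 2) =
    \sum_i \sum_j \tr M * (v i 0 ^+ 2 + v j 0 ^+ 2) / 2.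
  under [RHS]eq_bigr => i _.
    rewrite -mulr_suml -mulr_sumr big_split /= sumr_const card_ord.
    over.
  rewrite -mulr_suml -mulr_sumr big_split /= sumr_const card_ord.
  rewrite sumrMnl; set s := \sum_i _; rewrite -[s *+ n]mulr_natr.
  by move: (\tr M) (n%:R) s => a b c; field.
apply: ler_sum => i _; apply: ler_sum => j _.
apply: le_trans (ler_norm _) _; rewrite !normrM -mulrA mulrCA -mulrA.
apply: ler_pM => //; first exact: spd_norm_le_tr.
rewrite -[v i 0 ^+ 2]real_normK ?num_real// -[v j 0 ^+ 2]real_normK ?num_real//.
by have := sqr_ge0 (`|v j 0| - `|v i 0|); lra.
Qed.

(** Rescaling by c places B = 1 - M / c between 0 and 1, the added 1 keeping c positive when M = 0.
    The terms are explicit enough to be measurable in M, and so is their limit. *)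
Definition sqrt_approx M k : 'M[R]_n :=
  let c := 1 + n%:R * \tr M in
  Num.sqrt c *: (1%:M - sqrt_iter (1%:M - c^-1 *: M) k).

Lemma sqrt_approx_cvg M : spd_mx M ->
  exists2 S, spd_mx S /\ S *m S = M & mx_cvg (sqrt_approx M) S.
Proof.
move=> pM; pose c := 1 + n%:R * \tr M; pose B := 1%:M - c^-1 *: M.
have c0 : 0 < c by rewrite ltr_wpDr// mulr_ge0// spd_tr_ge0.
have pB : spd_mx B.
  have -> : B = c^-1 *: (1%:M + ((n%:R * \tr M)%:M - M)).
    rewrite addrA -raddfD -/c scalerBr -mul_scalar_mx -scalar_mxM.
    by rewrite mulVf ?gt_eqF.
  apply: spdZ; first by rewrite invr_ge0 ltW.
  by apply: spdD; [exact: spd1 | exact: spd_sub_scalar].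
have B1E : 1%:M - B = c^-1 *: M by rewrite /B opprB addrC subrK.
have pB1 : spd_mx (1%:M - B) by rewrite B1E; apply: spdZ; rewrite // invr_ge0 ltW.
have [Y cY pY] := sqrt_iter_cvg pB pB1.
(* The limit is a fixed point of the recursion, which reads (1 - Y)^2 = 1 - B = M / c. *)
have eY : 2 *: Y = B + Y *m Y.
  have c2 : mx_cvg (fun k => sqrt_iter B k.+1) (2^-1 *: (B + Y *m Y)).
    exact: mx_cvgZ (mx_cvgD (@mx_cvg_cst _ _ _ B) (mx_cvgM cY cY)).
  have c1 : mx_cvg (fun k => sqrt_iter B k.+1) Y.
    by move=> i j; have := cY i j; rewrite -cvg_shiftS.
  by rewrite {1}(mx_cvg_unique c1 c2) scalerA mulfV ?scale1r// pnatr_eq0.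
exists (Num.sqrt c *: (1%:M - Y)).
  split; first by apply: spdZ => //; exact: sqrtr_ge0.
  rewrite -scalemxAl -scalemxAr scalerA -expr2 sqr_sqrtr ?ltW//.
  have -> : (1%:M - Y) *m (1%:M - Y) = 1%:M - B.
    rewrite !(mulmxBl, mulmxBr, mul1mx, mulmx1).
    move: eY => /matrixP eY; apply/matrixP => i j; have := eY i j.
    by rewrite !mxE; lra.
  by rewrite B1E scalerA mulfV ?gt_eqF// scale1r.
exact: mx_cvgZ (mx_cvgB (@mx_cvg_cst _ _ _ 1%:M) cY).
Qed.

Lemma sqrt_mx_spec M : spd_mx M -> spd_mx (sqrt_mx M) /\ sqrt_mx M *m sqrt_mx M = M.
Proof.
move=> /sqrt_approx_cvg[S SM _]; rewrite /sqrt_mx.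
by case: xgetP => [? -> []//|/(_ S)].
Qed.

Lemma spd_sqrt M : spd_mx M -> spd_mx (sqrt_mx M).
Proof. by case/sqrt_mx_spec. Qed.

Lemma sqrt_mxK M : spd_mx M -> sqrt_mx M *m sqrt_mx M = M.
Proof. by case/sqrt_mx_spec. Qed.

Lemma sqrt_mx_sqr N : spd_mx N -> sqrt_mx (N *m N) = N.
Proof.
move=> pN; have pNN := spd_mulss pN.
by apply: spd_sqrt_unique (spd_sqrt pNN) pN (sqrt_mxK pNN).
Qed.

Lemma sqrt_approxP M : spd_mx M -> mx_cvg (sqrt_approx M) (sqrt_mx M).
Proof.
move=> pM; have [S [pS SS] cS] := sqrt_approx_cvg pM.
by rewrite -SS sqrt_mx_sqr// SS.
Qed.

Lemma trace_norm_spd M : spd_mx M -> trace_norm M = \tr M.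
Proof. by move=> pM; rewrite /trace_norm (spd_sym pM) sqrt_mx_sqr. Qed.

(** With S = [sqrt_mx M], the hypothesis says that (S X)^T (S X) vanishes. *)
Lemma spd_ker M X : spd_mx M -> X^T *m M *m X = 0 -> M *m X = 0.
Proof.
move=> pM; have sS := spd_sym (spd_sqrt pM).
rewrite -{1}(sqrt_mxK pM) !mulmxA -mulmxA -{1}sS -trmx_mul => SX0.
suff SX : sqrt_mx M *m X = 0 by rewrite -(sqrt_mxK pM) -mulmxA SX mulmx0.
by apply: frob_eq0; rewrite /frob SX0 mxtrace0.
Qed.

End SquareRoot.

(** * Matrices G with G G^T <= A *)

Section SubGreen.
Context {R : realType} {n : nat}.
Implicit Types (A D E G M N Q X Y Z : 'M[R]_n).

(** Serves to factor through a possibly singular M. *)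
Lemma submx_of_ker M Y :
  (forall V : 'M[R]_n, M *m V = 0 -> Y *m V = 0) -> (Y <= M)%MS.
Proof. by move=> MY; rewrite submxE MY// mulmx_coker. Qed.

(** With h = N^(1/2), a factorization X = N W^T gives tr X = <h, h W^T>, while the hypothesis
    conjugated by a J with J N = h gives |h W^T| <= |h|. The inequality of arithmetic and geometric
    means (AM-GM) concludes. *)
Lemma tr_le_of_gram X N : spd_mx N -> spd_mx (N *m N - X *m X^T) ->
  \tr X <= \tr N.
Proof.
move=> pN pNX; have sN := spd_sym pN; pose h := sqrt_mx N.
have sh : h^T = h by exact/spd_sym/spd_sqrt.
have hh : h *m h = N by exact: sqrt_mxK.
have /submxP[W XW] : (X^T <= N)%MS.
  apply: submx_of_ker => V NV0; apply: frob_eq0; apply/le_anti/andP; split.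
    have := spd_tr_ge0 (spd_conj V pNX).
    rewrite mulmxBr mulmxBl -!mulmxA NV0 !mulmx0 sub0r linearN /= oppr_ge0.
    by rewrite /frob trmx_mul trmxK -mulmxA.
  exact: frob_ge0.
have /submxP[J hE] : (h <= N)%MS.
  apply: submx_of_ker => V NV0; apply: frob_eq0.
  by rewrite /frob trmx_mul sh -mulmxA (mulmxA h) hh NV0 mulmx0 mxtrace0.
have XE : X = N *m W^T by rewrite -[LHS]trmxK XW trmx_mul sN.
have hE' : h = N *m J^T by rewrite -[LHS]sh {1}hE trmx_mul sN.
have trX : \tr X = frob h (h *m W^T) by rewrite /frob sh mulmxA hh -XE.
have trN : \tr N = frob h h by rewrite /frob sh hh.
have le : frob (h *m W^T) (h *m W^T) <= frob h h.
  rewrite -subr_ge0 !frob_trE -linearB /= sh.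
  have -> : h *m h - h *m W^T *m (h *m W^T)^T = J *m (N *m N - X *m X^T) *m J^T.
    rewrite mulmxBr mulmxBl XE !trmx_mul trmxK sN sh; congr (_ - _).
      by rewrite [LHS](congr2 mulmx hE hE') !mulmxA.
    have -> : h *m W^T *m (W *m h) = (J *m N) *m W^T *m (W *m (N *m J^T)).
      by rewrite -hE -hE'.
    by rewrite !mulmxA.
  exact/spd_tr_ge0/spd_conjT.
by have := frob_amgm h (h *m W^T); rewrite trX trN; lra.
Qed.

(** Y stands for A D (D A D)^+. It exists because D A D V = 0 gives (D V)^T A (D V) = 0, and then A
    D V = 0 as A is s.p.d. *)
Lemma solve_conj A D : spd_mx A -> D^T = D ->
  exists Y, Y *m (D *m A *m D) = A *m D.
Proof.
move=> pA sD; suff /submxP[Y] : (A *m D <= D *m A *m D)%MS by exists Y.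
apply: submx_of_ker => V DADV0; rewrite -mulmxA; apply: spd_ker => //.
by rewrite trmx_mul sD -!mulmxA in DADV0 *; rewrite DADV0 mulmx0.
Qed.

Lemma mulmx_sqr_cancel X N : N^T = N -> X *m N *m N = 0 -> X *m N = 0.
Proof.
by move=> sN XNN; apply: gram_eq0; rewrite trmx_mul sN mulmxA XNN mul0mx.
Qed.

(* The maximizer [A D N^+] of [frob D G] over the matrices [G] with [G G^T <= A]. *)
Lemma solve_conj_gram A D N Y : spd_mx A -> D^T = D -> spd_mx N ->
    N *m N = D *m A *m D -> Y *m (D *m A *m D) = A *m D ->
  D *m (Y *m N) = N /\ spd_mx (A - (Y *m N) *m (Y *m N)^T).
Proof.
move=> pA sD pN NN YE; have sN := spd_sym pN; have sA := spd_sym pA.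
have YD : D *m Y *m N = N.
  apply/eqP; rewrite -subr_eq0 -[X in _ - X]mul1mx -mulmxBl; apply/eqP.
  apply: mulmx_sqr_cancel => //; rewrite mulmxBl mulmxBl mul1mx.
  by rewrite -!mulmxA NN YE !mulmxA subrr.
split; first by rewrite mulmxA.
have ADY : A *m D *m Y^T = Y *m (D *m A).
  have -> : D *m A = D *m A *m D *m Y^T.
    by rewrite -{1}sD -{1}sA -trmx_mul -{1}YE !trmx_mul sA sD !mulmxA.
  by rewrite -{1}YE !mulmxA.
have YDAD : Y *m D *m A *m D = A *m D by rewrite -YE !mulmxA.
have -> : A - (Y *m N) *m (Y *m N)^T =
    (1%:M - Y *m D) *m A *m (1%:M - Y *m D)^T.
  rewrite linearB /= trmx1 !trmx_mul sN sD !mulmxBl !mulmxBr !mul1mx !mulmx1.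
  rewrite !mulmxA YDAD ADY -[Y *m N *m N]mulmxA NN YE ADY !mulmxA.
  by apply/matrixP => i j; rewrite !mxE; ring.
exact: spd_conjT.
Qed.

Lemma spd_add_scalar_unit N (a : R) : spd_mx N -> 0 < a -> N + a%:M \in unitmx.
Proof.
move=> pN a0; rewrite -row_free_unit -kermx_eq0; set V := kermx _.
have : V *m (N + a%:M) *m V^T = 0 by rewrite mulmx_ker mul0mx.
rewrite mulmxDr mulmxDl => /(congr1 mxtrace); rewrite mxtraceD mxtrace0.
rewrite mul_mx_scalar -scalemxAl mxtraceZ -(frob_trE V V) => eq0.
have := spd_tr_ge0 (spd_conjT V pN); have := frob_ge0 V => V0 VN0.
apply/eqP/frob_eq0/le_anti; rewrite V0 andbT -(pmulr_rle0 _ a0). lra.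
Qed.

(** A bound uniform in a: pairing (N + a) W = a with W gives |W|^2 <= tr W = <1, W> <= (n + |W|^2) /
    2. *)
Lemma frob_resolvent N (a : R) : spd_mx N -> 0 < a ->
  frob (a *: invmx (N + a%:M)) (a *: invmx (N + a%:M)) <= n%:R.
Proof.
move=> pN a0; set W := a *: _.
have NW : (N + a%:M) *m W = a%:M.
  by rewrite -scalemxAr mulmxV ?spd_add_scalar_unit// scalemx1.
clearbody W; have : W^T *m ((N + a%:M) *m W) = W^T *m a%:M by rewrite NW.
move=> /(congr1 mxtrace); rewrite mulmxDl mulmxDr mxtraceD mulmxA.
rewrite mul_scalar_mx -scalemxAr mul_mx_scalar !mxtraceZ mxtrace_tr -/(frob _ _).
move=> eqW; have WN0 := spd_tr_ge0 (spd_conj W pN).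
have : frob W W <= \tr W by rewrite -subr_ge0 -(pmulr_rge0 _ a0); lra.
have := frob_amgm 1%:M W.
have -> : frob 1%:M W = \tr W by rewrite /frob trmx1 mul1mx.
have -> : frob (1%:M : 'M[R]_n) 1%:M = n%:R.
  by rewrite /frob trmx1 mul1mx mxtrace1.
lra.
Qed.

(** N^2 (N + a)^-1 = N - a (1 - a (N + a)^-1), and the bracket stays bounded as a tends to 0. The
    sequence depends on Y only through Y N^2. *)
Lemma resolvent_cvg N Y : spd_mx N ->
  mx_cvg (fun k => Y *m (N *m N) *m invmx (N + (k.+1%:R^-1)%:M)) (Y *m N).
Proof.
move=> pN; pose W (a : R) := a *: invmx (N + a%:M).
have NNE (a : R) : 0 < a ->
    N *m N *m invmx (N + a%:M) = N - a *: (1%:M - W a).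
  move=> a0; have aU := spd_add_scalar_unit pN a0.
  apply: (can_inj (mulmxK aU)); rewrite mulmxKV// mulmxBl -scalemxAl mulmxBl.
  rewrite -scalemxAl mulVmx// mulmxDr mul1mx mul_mx_scalar -[a%:M]scalemx1.
  by apply/matrixP => i j; rewrite !mxE; ring.
under [X in mx_cvg X]eq_fun => k do rewrite -mulmxA NNE ?invr_gt0//.
apply: mx_cvgM; first exact: mx_cvg_cst.
rewrite -[X in mx_cvg _ X]subr0; apply: mx_cvgB; first exact: mx_cvg_cst.
move=> i j; rewrite [X in _ --> X]mxE.
pose C : R := 1 + (1 + n%:R).
apply/norm_cvg0P; apply: (@squeeze_cvgr _ _ _ _ (fun=> 0)
    (fun k => k.+1%:R^-1 * C)).
- apply: nearW => k; rewrite normr_ge0 /= mxE normrM ger0_norm ?invr_ge0//.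
  rewrite ler_wpM2l ?invr_ge0// mxE.
  apply: le_trans (ler_normD _ _) _; rewrite lerD//.
    by rewrite mxE; case: (_ == _); rewrite ?normr1// normr0.
  have a0 : 0 < k.+1%:R^-1 :> R by rewrite invr_gt0.
  have := le_trans (sqr_le_frob (W k.+1%:R^-1) i j) (frob_resolvent pN a0).
  rewrite [X in `|X|]mxE normrN -real_normK ?num_real//; set x := `|_|.
  have := sqr_ge0 (x - 1); have : (0 : R) <= n%:R by [].
  have : 0 <= x by exact: normr_ge0.
  by nra.
- exact: cvg_cst.
- rewrite -(mul0r C); apply: cvgM; last exact: cvg_cst.
  exact: cvg_harmonic.
Qed.

Lemma spd_sub_gram E : n%:R * frob E E <= 1 -> spd_mx (1%:M - E *m E^T).
Proof.
rewrite frob_trE => E1.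
have -> : 1%:M - E *m E^T = (1 - n%:R * \tr (E *m E^T)) *: 1%:M +
    ((n%:R * \tr (E *m E^T))%:M - E *m E^T).
  by rewrite scalemx1 addrA -raddfD subrK.
apply: spdD; last exact/spd_sub_scalar/spd_gram.
by apply: spdZ; [rewrite subr_ge0 | exact: spd1].
Qed.

(** The pair (G, Z) is transformed by the matrix with rows (1, t) and (t, -1), which is orthogonal
    up to the factor (1 + t^2)^(1/2). *)
Lemma gram_rotate (t : R) G Z :
  (G + t *: Z) *m (G + t *: Z)^T + (t *: G - Z) *m (t *: G - Z)^T =
  (1 + t ^+ 2) *: (G *m G^T + Z *m Z^T).
Proof.
apply/matrixP => i j; rewrite !mxE -!big_split /= mulr_sumr.
by apply: eq_bigr => k _; rewrite !mxE; ring.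
Qed.

(* Tilting [G] towards the defect [Q = A - G G^T] keeps [G G^T <= A], up to
   an error of second order in the step [t]. *)
Lemma subgreen_tilt A G D (c t : R) (Q := A - G *m G^T) :
    spd_mx A -> spd_mx Q -> n%:R * (c ^+ 2 * \tr (D^T *m Q *m D)) <= 1 ->
  let S := (1 + t ^+ 2)^-1 *: (G + (t * c) *: (Q *m D)) in
  spd_mx (A - S *m S^T).
Proof.
move=> pA pQ c1 S; pose Z := c *: (Q *m D); pose h := sqrt_mx Q.
have sh : h^T = h by exact/spd_sym/spd_sqrt.
have hh : h *m h = Q by exact: sqrt_mxK.
have u0 : 0 < 1 + t ^+ 2 by rewrite ltr_pwDl// sqr_ge0.
(* The smallness of c makes E = c h D a contraction, hence Z Z^T <= Q. *)
have pQZ : spd_mx (Q - Z *m Z^T).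
  pose E := c *: (h *m D).
  have -> : Q - Z *m Z^T = h *m (1%:M - E *m E^T) *m h.
    rewrite mulmxBr mulmxBl mulmx1 hh; congr (_ - _).
    rewrite /Z /E -hh !linearZ /= -!scalemxAl -!scalemxAr -!scalemxAl.
    by rewrite !trmx_mul sh !mulmxA.
  apply: (spd_conj_sym sh); apply: spd_sub_gram; apply: le_trans c1.
  rewrite /E frobZl frobZr [c * _]mulrA -expr2 /frob trmx_mul sh.
  by rewrite -!mulmxA (mulmxA h) hh.
have pT : spd_mx ((1 + t ^+ 2) *: A - (G + t *: Z) *m (G + t *: Z)^T).
  have -> : (1 + t ^+ 2) *: A - (G + t *: Z) *m (G + t *: Z)^T =
      (1 + t ^+ 2) *: (Q - Z *m Z^T) + (t *: G - Z) *m (t *: G - Z)^T.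
    have /(canRL (addrK _)) -> := gram_rotate t G Z.
    rewrite /Q; set g := G *m G^T; set z := Z *m Z^T; set y := _ *m _.
    by apply/matrixP => i j; rewrite !mxE; ring.
  by apply: spdD; [apply: spdZ => //; exact: ltW | exact: spd_gram].
(* The normalization divides by more than needed: (1 + t^2)^2 = (1 + t^2) + (t^2 + t^4). *)
have -> : A - S *m S^T = (1 + t ^+ 2)^-1 ^+ 2 *:
    (((1 + t ^+ 2) *: A - (G + t *: Z) *m (G + t *: Z)^T) +
     (t ^+ 2 + t ^+ 4) *: A).
  rewrite /S -[(t * c) *: _]scalerA -/Z; set X := G + t *: Z.
  rewrite linearZ /= -scalemxAl -scalemxAr.
  set XX := X *m X^T; apply/matrixP => i j; rewrite !mxE; field.
  by rewrite gt_eqF.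
apply: spdZ; first exact: sqr_ge0.
apply: spdD => //; apply: spdZ => //; rewrite addr_ge0 ?sqr_ge0//.
by rewrite (_ : t ^+ 4 = (t ^+ 2) ^+ 2) ?sqr_ge0// -exprM.
Qed.

End SubGreen.

(** * Measurability of matrix operations *)

Section MeasurableMatrix.
Context {R : realType} {d : measure_display} {T : measurableType d}.

(** The identity x^-1 = x (x^2)^-1 expresses the inverse through a real power of a nonnegative base;
    at x = 0 both sides are 0 by convention. *)
Lemma measurable_invr (f : T -> R) : measurable_fun setT f ->
  measurable_fun setT (fun x => (f x)^-1).
Proof.
move=> mf; rewrite (_ : (fun x => _) = fun x => f x * powR (f x ^+ 2) (-1)).
  apply: measurable_funM => //.
  by apply: (measurableT_comp (@measurable_powR R (-1))); exact: measurable_funX.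
apply/funext => x; rewrite powR_inv1 ?sqr_ge0// expr2.
have [->|f0] := eqVneq (f x) 0; first by rewrite mul0r invr0.
by rewrite invfM mulrA divff// mul1r.
Qed.

Lemma measurable_sqrtr (f : T -> R) : (forall x, 0 <= f x) ->
  measurable_fun setT f -> measurable_fun setT (fun x => Num.sqrt (f x)).
Proof.
move=> f0 mf; under eq_fun do rewrite -powR12_sqrt//.
exact: measurableT_comp (@measurable_powR R _) mf.
Qed.

Lemma measurable_mx_cst n (C : 'M[R]_n) : measurable_mx (fun _ : T => C).
Proof. by move=> i j; exact: measurable_cst. Qed.

Lemma measurable_mxD n (F G : T -> 'M[R]_n) : measurable_mx F ->
  measurable_mx G -> measurable_mx (fun x => F x + G x).
Proof.
move=> mF mG i j; under eq_fun do rewrite mxE.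
exact: measurable_funD (mF i j) (mG i j).
Qed.

Lemma measurable_mxZ n (f : T -> R) (F : T -> 'M[R]_n) : measurable_fun setT f ->
  measurable_mx F -> measurable_mx (fun x => f x *: F x).
Proof.
move=> mf mF i j; under eq_fun do rewrite mxE.
exact: measurable_funM mf (mF i j).
Qed.

Lemma measurable_mxB n (F G : T -> 'M[R]_n) : measurable_mx F ->
  measurable_mx G -> measurable_mx (fun x => F x - G x).
Proof.
move=> mF mG i j; under eq_fun do rewrite !mxE.
exact: measurable_funB (mF i j) (mG i j).
Qed.

Lemma measurable_mxM n (F G : T -> 'M[R]_n) : measurable_mx F ->
  measurable_mx G -> measurable_mx (fun x => F x *m G x).
Proof.
move=> mF mG i j; under eq_fun do rewrite mxE.
by apply: measurable_sum => k; exact: measurable_funM (mF _ _) (mG _ _).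
Qed.

Lemma measurable_trmx n (F : T -> 'M[R]_n) : measurable_mx F ->
  measurable_mx (fun x => (F x)^T).
Proof. by move=> mF i j; under eq_fun do rewrite mxE; exact: mF. Qed.

Lemma measurable_mxtrace n (F : T -> 'M[R]_n) : measurable_mx F ->
  measurable_fun setT (fun x => \tr (F x)).
Proof. by move=> mF; apply: measurable_sum => i; exact: mF. Qed.

Lemma measurable_det n (F : T -> 'M[R]_n) : measurable_mx F ->
  measurable_fun setT (fun x => \det (F x)).
Proof.
move=> mF; apply: measurable_sum => s; apply: measurable_funM.
  exact: measurable_cst.
by apply: measurable_prod => i _; exact: mF.
Qed.

(** Cofactor formula: determinant and adjugate are polynomial in the entries. *)
Lemma measurable_invmx n (F : T -> 'M[R]_n) : measurable_mx F ->
  (forall x, F x \in unitmx) -> measurable_mx (fun x => invmx (F x)).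
Proof.
move=> mF uF; under eq_fun do rewrite /invmx uF.
apply: measurable_mxZ; first exact/measurable_invr/measurable_det.
move=> i j; under eq_fun do rewrite mxE.
apply: measurable_funM; first exact: measurable_cst.
by apply: measurable_det => k l; under eq_fun do rewrite !mxE; exact: mF.
Qed.

Lemma measurable_mx_lim n (F : nat -> T -> 'M[R]_n) (G : T -> 'M[R]_n) :
  (forall k, measurable_mx (F k)) -> (forall x, mx_cvg (F^~ x) (G x)) ->
  measurable_mx G.
Proof.
move=> mF FG i j; apply: (measurable_fun_cvg (fun k => mF k i j)) => x _.
exact: FG.
Qed.

(** [sqrt_mx] is picked by [xget], so measurability comes from the explicit approximations that
    converge to it. *)
Lemma measurable_sqrt_mx n (F : T -> 'M[R]_n) : measurable_mx F ->
  (forall x, spd_mx (F x)) -> measurable_mx (fun x => sqrt_mx (F x)).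
Proof.
move=> mF pF; pose c x := 1 + n%:R * \tr (F x).
have c0 x : 0 <= c x by rewrite addr_ge0// mulr_ge0// spd_tr_ge0.
have mc : measurable_fun setT c.
  apply: measurable_funD; first exact: measurable_cst.
  by apply: measurable_funM; [exact: measurable_cst | exact: measurable_mxtrace].
apply: (measurable_mx_lim (F := fun k x => sqrt_approx (F x) k)); last first.
  by move=> x; exact: sqrt_approxP.
move=> k; apply: measurable_mxZ; first exact: measurable_sqrtr.
apply: measurable_mxB; first exact: measurable_mx_cst.
elim: k => [|k IH] /=; first exact: measurable_mx_cst.
apply: measurable_mxZ; first exact: measurable_cst.
apply: measurable_mxD; last exact: measurable_mxM.
apply: measurable_mxB; first exact: measurable_mx_cst.
by apply: measurable_mxZ => //; exact: measurable_invr.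
Qed.

End MeasurableMatrix.

(** * Entrywise integrals of matrix functions *)

Section MatrixIntegral.
Context {R : realType} {d : measure_display} {T : measurableType d}.
Variable mu : {measure set T -> \bar R}.

Definition Rintegrable (f : T -> R) : Prop := mu.-integrable setT (EFin \o f).

Lemma Rintegrable_measurable f : Rintegrable f -> measurable_fun setT f.
Proof. by move=> /measurable_int /measurable_EFinP. Qed.

Lemma RintegrableD f g : Rintegrable f -> Rintegrable g ->
  Rintegrable (fun x => f x + g x).
Proof. by move=> If Ig; exact: (integrableD measurableT If Ig). Qed.

Lemma RintegrableZ a f : Rintegrable f -> Rintegrable (fun x => a * f x).
Proof. by move=> If; exact: (integrableZl measurableT a If). Qed.

Lemma Rintegrable_sum (I : Type) (s : seq I) (f : I -> T -> R) :
  (forall i, Rintegrable (f i)) -> Rintegrable (fun x => \sum_(i <- s) f i x).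
Proof.
move=> If.
rewrite /Rintegrable (_ : _ \o _ = fun x => (\sum_(i <- s) (f i x)%:E)%E).
  by apply: integrable_sum => // i _; exact: If.
by apply/funext => x /=; rewrite sumEFin.
Qed.

Lemma Rintegral_sum (I : Type) (s : seq I) (f : I -> T -> R) :
  (forall i, Rintegrable (f i)) ->
  \int[mu]_x (\sum_(i <- s) f i x) = \sum_(i <- s) \int[mu]_x f i x.
Proof.
move=> If; rewrite /Rintegral.
under eq_integral do rewrite -sumEFin.
rewrite integral_sum//.
rewrite sum_fine// => i _.
exact: (integrable_fin_num measurableT (If i)).
Qed.

Lemma Rintegrable_le (f g : T -> R) : measurable_fun setT f -> Rintegrable g ->
  (forall x, `|f x| <= g x) -> Rintegrable f.
Proof.
move=> mf Ig fg; apply: le_integrable Ig => //; first exact/measurable_EFinP.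
by move=> x _ /=; rewrite lee_fin; apply: le_trans (fg x) (ler_norm _).
Qed.

Lemma Rintegral_ae (f g : T -> R) : measurable_fun setT f -> measurable_fun setT g ->
  {ae mu, forall x, f x = g x} -> \int[mu]_x f x = \int[mu]_x g x.
Proof.
move=> mf mg fg; congr fine; apply: ae_eq_integral => //.
- exact/measurable_EFinP.
- exact/measurable_EFinP.
- by move: fg; apply: filterS => x fgx _; rewrite fgx.
Qed.

Definition mx_integrable n (F : T -> 'M[R]_n) : Prop :=
  forall i j, Rintegrable (fun x => F x i j).

Lemma mx_integrable_measurable n (F : T -> 'M[R]_n) :
  mx_integrable F -> measurable_mx F.
Proof. by move=> IF i j; exact: Rintegrable_measurable (IF i j). Qed.

Lemma mx_integralD n (F G : T -> 'M[R]_n) : mx_integrable F -> mx_integrable G ->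
  mx_integral mu (fun x => F x + G x) = mx_integral mu F + mx_integral mu G.
Proof.
move=> IF IG; apply/matrixP => i j; rewrite !mxE -RintegralD//.
  by apply: eq_Rintegral => x _; rewrite mxE.
exact: IF.
exact: IG.
Qed.

Lemma mx_integrable_mull n (C : 'M[R]_n) (F : T -> 'M[R]_n) : mx_integrable F ->
  mx_integrable (fun x => C *m F x).
Proof.
move=> IF i j; rewrite /Rintegrable; under eq_fun do rewrite mxE.
by apply: Rintegrable_sum => k; exact/RintegrableZ/IF.
Qed.

Lemma mx_integral_mull n (C : 'M[R]_n) (F : T -> 'M[R]_n) : mx_integrable F ->
  mx_integral mu (fun x => C *m F x) = C *m mx_integral mu F.
Proof.
move=> IF; apply/matrixP => i j; rewrite !mxE.
under eq_Rintegral do rewrite mxE.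
rewrite Rintegral_sum => [|k]; last exact/RintegrableZ/IF.
by apply: eq_bigr => k _; rewrite mxE RintegralZl//; exact: IF.
Qed.

Lemma mx_integrable_tr n (F : T -> 'M[R]_n) : mx_integrable F ->
  mx_integrable (fun x => (F x)^T).
Proof.
by move=> IF i j; rewrite /Rintegrable; under eq_fun do rewrite mxE; exact: IF.
Qed.

Lemma mx_integral_tr n (F : T -> 'M[R]_n) :
  mx_integral mu (fun x => (F x)^T) = (mx_integral mu F)^T.
Proof.
apply/matrixP => i j; rewrite !mxE.
by apply: eq_Rintegral => x _; rewrite mxE.
Qed.

Lemma mx_integrable_mulr n (C : 'M[R]_n) (F : T -> 'M[R]_n) : mx_integrable F ->
  mx_integrable (fun x => F x *m C).
Proof.
move=> IF; have := mx_integrable_tr (mx_integrable_mull C^T (mx_integrable_tr IF)).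
by under [X in mx_integrable X]eq_fun do rewrite trmx_mul !trmxK.
Qed.

Lemma mx_integral_mulr n (C : 'M[R]_n) (F : T -> 'M[R]_n) : mx_integrable F ->
  mx_integral mu (fun x => F x *m C) = mx_integral mu F *m C.
Proof.
move=> IF; apply: trmx_inj; rewrite -mx_integral_tr trmx_mul -mx_integral_tr.
rewrite -mx_integral_mull; last exact: mx_integrable_tr.
by under eq_fun do rewrite trmx_mul.
Qed.

Lemma Rintegrable_mxtrace n (F : T -> 'M[R]_n) : mx_integrable F ->
  Rintegrable (fun x => \tr (F x)).
Proof. by move=> IF; apply: Rintegrable_sum => i; exact: IF. Qed.

Lemma Rintegral_mxtrace n (F : T -> 'M[R]_n) : mx_integrable F ->
  \int[mu]_x \tr (F x) = \tr (mx_integral mu F).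
Proof.
move=> IF; rewrite /mxtrace Rintegral_sum => [|i]; last exact: IF.
by apply: eq_bigr => i _; rewrite mxE.
Qed.

Lemma Rintegrable_frob n (C : 'M[R]_n) (F : T -> 'M[R]_n) : mx_integrable F ->
  Rintegrable (fun x => frob C (F x)).
Proof. by move=> IF; exact/Rintegrable_mxtrace/mx_integrable_mull. Qed.

Lemma Rintegral_frob n (C : 'M[R]_n) (F : T -> 'M[R]_n) : mx_integrable F ->
  \int[mu]_x frob C (F x) = frob C (mx_integral mu F).
Proof.
move=> IF; rewrite /frob -mx_integral_mull// -Rintegral_mxtrace//.
exact: mx_integrable_mull.
Qed.

Lemma qformE n (M : 'M[R]_n) (u v : 'cV[R]_n) :
  qform M u v = frob (u *m v^T) M.
Proof.
by rewrite /frob trmx_mul trmxK -mulmxA mxtrace_mulC trace_mx11.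
Qed.

Lemma Rintegrable_qform n (F : T -> 'M[R]_n) u v : mx_integrable F ->
  Rintegrable (fun x => qform (F x) u v).
Proof. by move=> IF; under eq_fun do rewrite qformE; exact: Rintegrable_frob. Qed.

Lemma Rintegral_qform n (F : T -> 'M[R]_n) u v : mx_integrable F ->
  \int[mu]_x qform (F x) u v = qform (mx_integral mu F) u v.
Proof.
by move=> IF; under eq_Rintegral do rewrite qformE; rewrite Rintegral_frob// qformE.
Qed.

Lemma mx_integral_ae n (F G : T -> 'M[R]_n) : measurable_mx F ->
  measurable_mx G -> {ae mu, forall x, F x = G x} ->
  mx_integral mu F = mx_integral mu G.
Proof.
move=> mF mG FG; apply/matrixP => i j; rewrite !mxE; apply: Rintegral_ae => //.
by move: FG; apply: filterS => x ->.
Qed.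

End MatrixIntegral.

(** Replaces a passage to the limit: divide by k + 1 and let k grow. *)
Lemma affine_nat_ge0 (R : realType) (a b : R) :
  (forall k, 0 <= k.+1%:R * a + b) -> 0 <= a.
Proof.
move=> ab; rewrite leNgt; apply/negP => a0.
have na0 : 0 < - a by rewrite oppr_gt0.
have := archi_boundP (divr_ge0 (normr_ge0 b) (ltW na0)).
set m := Num.bound _; rewrite ltr_pdivrMr// => mb.
have := ab m; have := ler_norm b; rewrite -natr1; lra.
Qed.

(** * Kernels, their partial means and the block inequality *)

Section KernelSections.
Context {R : realType} {n : nat} {d : measure_display} {T : measurableType d}.
Variables (P : probability T R) (A : T -> 'M[R]_n).

Lemma Rintegrable_cst (a : R) : Rintegrable P (fun=> a).
Proof. exact: (finite_measure_integrable_cst P a measurableT). Qed.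

Lemma Rintegral_cstP (a : R) : \int[P]_x a = a.
Proof. by rewrite Rintegral_cst//= probability_setT mulr1. Qed.

Lemma Rintegrable_prod1 (f : T -> R) : Rintegrable P f ->
  Rintegrable (P \x P)%E (fun z => f z.1).
Proof.
move=> If; have mf := Rintegrable_measurable If.
apply/integrable12ltyP.
  by apply/measurable_EFinP; exact: (measurableT_comp mf measurable_fst).
under eq_integral do
  rewrite /= integral_cst// [X in (_ * X)%E](probability_setT P) mule1.
by have /integrableP[] := If.
Qed.

Lemma Rintegrable_prod2 (f : T -> R) : Rintegrable P f ->
  Rintegrable (P \x P)%E (fun z => f z.2).
Proof.
move=> If; have mf := Rintegrable_measurable If.
apply/integrable21ltyP.
  by apply/measurable_EFinP; exact: (measurableT_comp mf measurable_snd).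
under eq_integral do
  rewrite /= integral_cst// [X in (_ * X)%E](probability_setT P) mule1.
by have /integrableP[] := If.
Qed.

(** Sections are asked to be integrable everywhere, so that the real-valued inner integral agrees
    with the extended one at every point. *)
Lemma Rintegral_fubini (f : T * T -> R) :
    Rintegrable (P \x P)%E f ->
    (forall x, Rintegrable P (fun y => f (x, y))) ->
  Rintegrable P (fun x => \int[P]_y f (x, y)) /\
  \int[P]_x (\int[P]_y f (x, y)) = \int[(P \x P)%E]_z f z.
Proof.
move=> If Isec.
have E : fubini_F P (EFin \o f) = EFin \o (fun x => \int[P]_y f (x, y)).
  apply/funext => x; rewrite /fubini_F /= fineK//.
  exact: (integrable_fin_num measurableT (Isec x)).
split; first by rewrite /Rintegrable -E; exact: integrable_fubini_F.
by congr fine; rewrite -(integral12_prod_meas1 If) E.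
Qed.

Lemma Rintegral_fubini_swap (f : T * T -> R) :
    Rintegrable (P \x P)%E f ->
    (forall y, Rintegrable P (fun x => f (x, y))) ->
  \int[P]_y (\int[P]_x f (x, y)) = \int[(P \x P)%E]_z f z.
Proof.
move=> If Isec.
have E : fubini_G P (EFin \o f) = EFin \o (fun y => \int[P]_x f (x, y)).
  apply/funext => y; rewrite /fubini_G /= fineK//.
  exact: (integrable_fin_num measurableT (Isec y)).
by congr fine; rewrite -(integral21_prod_meas1 If) E.
Qed.

Hypothesis IA : mx_integrable P A.
Variable K : T * T -> 'M[R]_n.
Hypothesis hK : random_kernel A K.

(** Lists make it easy to prepend a point, as the induction in [kernel_mean_sum_ge0] does. *)
Lemma kernel_sum_ge0 (s : seq (T * 'cV[R]_n)) :
  0 <= \sum_(p <- s) \sum_(q <- s) qform (K (p.1, q.1)) p.2 q.2.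
Proof.
have [_ _ _ psdK] := hK; pose t := tnth (in_tuple s).
have := psdK (size s) (fun i => (t i).1) (fun i => (t i).2).
rewrite [X in _ -> 0 <= X]big_tnth.
under [X in _ -> 0 <= X]eq_bigr do rewrite big_tnth.
exact.
Qed.

(** Positivity at the two points w and w', with the vectors e_i and e_j or - e_j; the bound
    dominates the integrals of K and of its sections. *)
Lemma kernel_normE w w' i j : `|K (w, w') i j| <= (A w i i + A w' j j) / 2.
Proof.
have [_ diagK symK _] := hK.
have sK : K (w', w) j i = K (w, w') i j by rewrite symK mxE.
have := kernel_sum_ge0 [:: (w, delta_mx i 0); (w', delta_mx j 0)].
have := kernel_sum_ge0 [:: (w, delta_mx i 0); (w', (-1) *: delta_mx j 0)].
rewrite !big_cons !big_nil /= !(qformZl, qformZr, qform_delta) !diagK sK.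
by move=> h1 h2; rewrite ler_norml; apply/andP; split; lra.
Qed.

Lemma kernel_integrable : mx_integrable (P \x P)%E K.
Proof.
have [mK _ _ _] := hK => i j.
apply: (Rintegrable_le (g := fun z => 2^-1 * (A z.1 i i + A z.2 j j))).
- exact: mK.
- apply: RintegrableZ; apply: RintegrableD.
    exact: (@Rintegrable_prod1 (fun x => A x i i) (IA i i)).
  exact: (@Rintegrable_prod2 (fun x => A x j j) (IA j j)).
- by move=> [x y] /=; rewrite mulrC kernel_normE.
Qed.

Lemma kernel_section_integrable w : mx_integrable P (fun w' => K (w, w')).
Proof.
have [mK _ _ _] := hK => i j.
apply: (Rintegrable_le (g := fun y => 2^-1 * (A w i i + A y j j))).
- exact: (@measurable_fun_pair2 _ _ _ _ _ _ (fun z => K z i j)).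
- by apply: RintegrableZ; apply: RintegrableD (Rintegrable_cst _) (IA j j).
- by move=> y /=; rewrite mulrC kernel_normE.
Qed.

Definition kernel_mean w : 'M[R]_n := mx_integral P (fun w' => K (w, w')).

Lemma kernel_mean_fubini : mx_integrable P kernel_mean /\
  mx_integral P kernel_mean = kernel_hat P K.
Proof.
have F i j := Rintegral_fubini (kernel_integrable i j)
  (fun w => kernel_section_integrable w i j).
split=> [i j|].
  by rewrite /Rintegrable; under eq_fun do rewrite mxE; exact: (F i j).1.
apply/matrixP => i j; rewrite !mxE -(F i j).2.
by apply: eq_Rintegral => x _; rewrite mxE.
Qed.

(** Fubini in the two orders, combined with K (x, y) = K (y, x)^T. *)
Lemma kernel_hat_sym : (kernel_hat P K)^T = kernel_hat P K.
Proof.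
have [_ _ symK _] := hK; apply/matrixP => i j; rewrite !mxE.
rewrite -(Rintegral_fubini (kernel_integrable j i)
  (fun w => kernel_section_integrable w j i)).2.
have E x y : K (x, y) j i = K (y, x) i j by rewrite symK mxE.
under eq_Rintegral do under eq_Rintegral do rewrite E.
apply: (@Rintegral_fubini_swap (fun z => K z i j)); first exact: kernel_integrable.
move=> y; rewrite (_ : (fun x => _) = fun x => K (y, x) j i).
  exact: kernel_section_integrable.
by apply/funext => x; rewrite E.
Qed.

(* The kernel inequality for the points of [s] together with [k] independent
   random points carrying the vector [u], averaged over the latter. *)
Lemma kernel_mean_sum_ge0 u k (s : seq (T * 'cV[R]_n)) :
  0 <= \sum_(p <- s) \sum_(q <- s) qform (K (p.1, q.1)) p.2 q.2 +
    2 * k%:R * (\sum_(p <- s) qform (kernel_mean p.1) p.2 u) +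
    k%:R * qform (mx_integral P A) u u +
    k%:R * (k%:R - 1) * qform (kernel_hat P K) u u.
Proof.
have [_ diagK symK _] := hK; have [If Ef] := kernel_mean_fubini.
elim: k s => [|k IH] s.
  by have := kernel_sum_ge0 s; rewrite !(mul0r, mulr0, addr0).
set S := \sum_(p <- s) _; set F := \sum_(p <- s) _.
pose c := S + 2 * k%:R * F + k%:R * qform (mx_integral P A) u u +
  k%:R * (k%:R - 1) * qform (kernel_hat P K) u u.
pose g x := \sum_(p <- s) qform (K (p.1, x)) p.2 u.
have Ig : Rintegrable P g.
  apply: Rintegrable_sum => p.
  exact/Rintegrable_qform/kernel_section_integrable.
have Eg : \int[P]_x g x = F.
  rewrite Rintegral_sum => [|p].
    apply: eq_bigr => p _; rewrite Rintegral_qform//.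
    exact: kernel_section_integrable.
  exact/Rintegrable_qform/kernel_section_integrable.
have IuA : Rintegrable P (fun x => qform (A x) u u) by exact: Rintegrable_qform.
have Iuf : Rintegrable P (fun x => qform (kernel_mean x) u u).
  exact: Rintegrable_qform.
(* The induction hypothesis for s with a random point x prepended is integrated over x; the new
   cross terms turn the coefficient k (k - 1) into k (k - 1) + 2 k = (k + 1) k. *)
have : 0 <= \int[P]_x (c + (qform (A x) u u +
    (2 * g x + 2 * k%:R * qform (kernel_mean x) u u))).
  apply: Rintegral_ge0 => x _; have := IH ((x, u) :: s).
  have -> : \sum_(p <- (x, u) :: s) \sum_(q <- (x, u) :: s)
      qform (K (p.1, q.1)) p.2 q.2 = qform (A x) u u + 2 * g x + S.
    rewrite big_cons big_cons /= diagK.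
    under [X in _ + X = _]eq_bigr do rewrite big_cons.
    rewrite big_split /= -/S -/(g x).
    have -> : \sum_(q <- s) qform (K (x, q.1)) u q.2 = g x.
      by apply: eq_bigr => q _; rewrite symK qform_tr.
    ring.
  rewrite big_cons /= -/F /c; lra.
have I2g : Rintegrable P (fun x => 2 * g x) by exact: RintegrableZ.
have I2f : Rintegrable P (fun x => 2 * k%:R * qform (kernel_mean x) u u).
  exact: RintegrableZ.
rewrite (RintegralD measurableT (Rintegrable_cst c)
  (RintegrableD IuA (RintegrableD I2g I2f))).
rewrite (RintegralD measurableT IuA (RintegrableD I2g I2f)).
rewrite (RintegralD measurableT I2g I2f) Rintegral_cstP.
rewrite (RintegralZl _ measurableT Ig) (RintegralZl _ measurableT Iuf) Eg.
rewrite !Rintegral_qform// Ef /c -natr1; lra.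
Qed.

(** The point w carries (k + 1) v against k + 1 random points carrying u, so that all the wanted
    terms grow like (k + 1)^2, while the diagonal correction E A - [kernel_hat] only grows like k +
    1. *)
Lemma kernel_block_ge0 w u v :
  0 <= qform (A w) v v + 2 * qform (kernel_mean w) v u + qform (kernel_hat P K) u u.
Proof.
have [_ diagK _ _] := hK.
apply: (@affine_nat_ge0 _ _
  (qform (mx_integral P A) u u - qform (kernel_hat P K) u u)).
move=> k; have := kernel_mean_sum_ge0 u k.+1 [:: (w, k.+1%:R *: v)].
rewrite !big_cons !big_nil /= !(qformZl, qformZr) diagK !addr0 => le0.
rewrite -(pmulr_rge0 _ (ltr0Sn R k)); apply: le_trans le0 _.
rewrite le_eqVlt; apply/orP; left; apply/eqP; ring.
Qed.

Lemma kernel_hat_spd : spd_mx (kernel_hat P K).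
Proof.
split=> [|u]; first exact: kernel_hat_sym.
apply: (@affine_nat_ge0 _ _ (qform (mx_integral P A) u u)) => k.
(* There are (k + 2) (k + 1) ordered pairs of distinct points; dividing by k + 2 leaves the slope k
   + 1 that [affine_nat_ge0] expects. *)
have := kernel_mean_sum_ge0 u k.+2 [::].
rewrite !big_nil !(mulr0, add0r) -mulrA -mulrDr pmulr_rge0// -natr1 addrK.
by rewrite addrC.
Qed.

End KernelSections.

(** * Green's matrices and the kernels they generate *)

Section Greens.
Context {R : realType} {n : nat} {d : measure_display} {T : measurableType d}.
Variables (P : probability T R) (A : T -> 'M[R]_n).
Implicit Types (G H S : T -> 'M[R]_n) (K L : T * T -> 'M[R]_n).

Lemma le_hs_norm (X Y : 'M[R]_n) : (hs_norm X <= hs_norm Y) = (frob X X <= frob Y Y).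
Proof. by rewrite /hs_norm ler_sqrt// frob_ge0. Qed.

(** The constraint is imposed at every point, so that the root of the defect is s.p.d. and
    measurable everywhere. *)
Definition subgreen G : Prop :=
  measurable_mx G /\ forall w, spd_mx (A w - G w *m (G w)^T).

Hypothesis hA : random_covariance A.

Lemma covariance_integrable :
  ('E_P[fun w => trace_norm (A w)] < +oo)%E -> mx_integrable P A.
Proof.
have [mA pA] := hA => trA i j.
apply: (Rintegrable_le (g := fun w => \tr (A w))); first exact: mA.
- apply/integrableP; split.
    by apply/measurable_EFinP; exact: measurable_mxtrace.
  move: trA; rewrite unlock; apply: le_lt_trans.
  rewrite le_eqVlt; apply/orP; left; apply/eqP; apply: eq_integral => w _ /=.
  by rewrite trace_norm_spd// ger0_norm// spd_tr_ge0.
- by move=> w; exact: spd_norm_le_tr.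
Qed.

Hypothesis IA : mx_integrable P A.

(** |G_ij|^2 <= tr A, and |x| <= 1 + x^2. *)
Lemma subgreen_integrable G : subgreen G -> mx_integrable P G.
Proof.
move=> [mG sG] i j; apply: (Rintegrable_le (g := fun w => 1 + \tr (A w))).
- exact: mG.
- exact: RintegrableD (Rintegrable_cst _ _) (Rintegrable_mxtrace IA).
- move=> w; have := spd_tr_ge0 (sG w); rewrite linearB /= -frob_trE.
  have := sqr_le_frob (G w) i j; rewrite -real_normK ?num_real//.
  have : 0 <= (`|G w i j| - 1) ^+ 2 by exact: sqr_ge0.
  have : 0 <= `|G w i j| by exact: normr_ge0.
  by rewrite expr2; nra.
Qed.

Lemma exact_subgreen G : measurable_mx G ->
  (forall w, G w *m (G w)^T = A w) -> subgreen G.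
Proof. by move=> mG GA; split=> // w; rewrite GA subrr; exact: spd0. Qed.

(** Where the factorization fails, which is a measurable set, G is replaced by [sqrt_mx (A w)]. An
    exact version is needed because [random_kernel] fixes the diagonal at each point. *)
Lemma green_correct G : random_green P A G ->
  exists G', [/\ measurable_mx G', forall w, G' w *m (G' w)^T = A w,
    forall w, G w *m (G w)^T = A w -> G' w = G w &
    {ae P, forall w, G w = G' w}].
Proof.
have [mA pA] := hA => -[mG GA].
pose X w := G w *m (G w)^T - A w; pose b w := frob (X w) (X w) == 0.
have bP w : reflect (G w *m (G w)^T = A w) (b w).
  apply: (iffP eqP) => [/frob_eq0/eqP|GAw]; first by rewrite subr_eq0 => /eqP.
  by rewrite /X GAw subrr /frob trmx0 mul0mx mxtrace0.
have mX : measurable_mx X.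
  exact: measurable_mxB (measurable_mxM mG (measurable_trmx mG)) mA.
exists (fun w => if b w then G w else sqrt_mx (A w)); split.
- move=> i j.
  rewrite (_ : (fun w => _) = fun w => if b w then G w i j else sqrt_mx (A w) i j).
    apply: measurable_fun_ifT; [|exact: mG|exact: (measurable_sqrt_mx mA pA)].
    apply: measurable_fun_eqr; last exact: measurable_cst.
    exact/measurable_mxtrace/(measurable_mxM (measurable_trmx mX) mX).
  by apply/funext => w; case: (b w).
- move=> w; case: (bP w) => // _.
  by rewrite (spd_sym (spd_sqrt (pA w))) sqrt_mxK.
- by move=> w /bP ->.
- by move: GA; apply: filterS => w /bP ->.
Qed.

Lemma green_section_mean G w : random_green P A G ->
  mx_integral P (fun w' => G w *m (G w')^T) = G w *m (mx_integral P G)^T.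
Proof.
move=> hG; have [G' [mG' G'A _ GG']] := green_correct hG; have [mG _] := hG.
rewrite (mx_integral_ae mG mG' GG') -mx_integral_tr -mx_integral_mull; last first.
  exact/mx_integrable_tr/subgreen_integrable/exact_subgreen.
apply: mx_integral_ae.
- exact: measurable_mxM (measurable_mx_cst _) (measurable_trmx mG).
- exact: measurable_mxM (measurable_mx_cst _) (measurable_trmx mG').
- by move: GG'; apply: filterS => w' ->.
Qed.

(** Positivity holds since each summand F contributes |sum_i F(w_i)^T v_i|^2. The factor H completes
    a subgreen G to the full diagonal; H = 0 is the exact case. *)
Lemma sum_green_kernel G H : measurable_mx G -> measurable_mx H ->
    (forall w, G w *m (G w)^T + H w *m (H w)^T = A w) ->
  let K z := green_kernel G z + green_kernel H z in
  random_kernel A K /\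
  kernel_hat P K = mx_integral P G *m (mx_integral P G)^T +
                   mx_integral P H *m (mx_integral P H)^T.
Proof.
move=> mG mH GH K.
have mgreen F : measurable_mx F -> measurable_mx (green_kernel F).
  move=> mF; apply: measurable_mxM => [i j|].
    exact: (measurableT_comp (mF i j) measurable_fst).
  apply: measurable_trmx => i j.
  exact: (measurableT_comp (mF i j) measurable_snd).
have psd F m (w : 'I_m -> T) (v : 'I_m -> 'cV[R]_n) :
    0 <= \sum_(i < m) \sum_(j < m) qform (green_kernel F (w i, w j)) (v i) (v j).
  pose x := \sum_(i < m) (F (w i))^T *m v i.
  have -> : \sum_(i < m) \sum_(j < m) qform (green_kernel F (w i, w j)) (v i) (v j) =
      qform 1%:M x x.
    rewrite /qform mulmx1; have -> : x^T = \sum_(i < m) ((F (w i))^T *m v i)^T.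
      by rewrite /x linear_sum.
    rewrite mulmx_suml summxE; apply: eq_bigr => i _.
    rewrite mulmx_sumr summxE; apply: eq_bigr => j _.
    by rewrite /green_kernel /= trmx_mul trmxK !mulmxA.
  exact: qform1_ge0.
have hK : random_kernel A K.
  split=> [|w|w w'|m w v].
  - by apply: measurable_mxD; exact: mgreen.
  - exact: GH.
  - by rewrite /K /green_kernel linearD /= !trmx_mul !trmxK.
  - under eq_bigr do under eq_bigr do rewrite -/(qform _ _ _) qformDm.
    under eq_bigr do rewrite big_split /=.
    by rewrite big_split /= addr_ge0 ?psd.
split=> //; have [_ <-] := kernel_mean_fubini IA hK.
have sG : subgreen G.
  by split=> // w; rewrite -GH addrC addKr; exact: spd_gram.
have sH : subgreen H.
  by split=> // w; rewrite -GH addrK; exact: spd_gram.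
have IG := subgreen_integrable sG; have IH := subgreen_integrable sH.
rewrite -!mx_integral_mulr// -mx_integralD; [|exact: mx_integrable_mulr..].
congr mx_integral; apply/funext => w; rewrite /kernel_mean /K /green_kernel /=.
rewrite mx_integralD; [|exact/mx_integrable_mull/mx_integrable_tr..].
by rewrite !mx_integral_mull ?mx_integral_tr//; exact: mx_integrable_tr.
Qed.

Lemma subgreen_kernel G : subgreen G -> exists2 K, random_kernel A K &
  frob (mx_integral P G) (mx_integral P G) <= \tr (kernel_hat P K).
Proof.
move=> [mG sG]; have [mA _] := hA; pose H w := sqrt_mx (A w - G w *m (G w)^T).
have mH : measurable_mx H.
  apply: measurable_sqrt_mx => //.
  exact: measurable_mxB mA (measurable_mxM mG (measurable_trmx mG)).
have [|hK EK] := sum_green_kernel mG mH.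
  move=> w; rewrite (spd_sym (spd_sqrt (sG w))) (sqrt_mxK (sG w)) addrC.
  by rewrite subrK.
eexists; first exact: hK.
by rewrite EK mxtraceD -!frob_trE lerDl frob_ge0.
Qed.

Lemma exact_green_kernel G : measurable_mx G ->
    (forall w, G w *m (G w)^T = A w) ->
  random_kernel A (green_kernel G) /\
  kernel_hat P (green_kernel G) = mx_integral P G *m (mx_integral P G)^T.
Proof.
move=> mG GA; have [|] := sum_green_kernel mG (measurable_mx_cst (0 : 'M[R]_n)).
  by move=> w; rewrite mul0mx addr0.
have -> : (fun z => green_kernel G z + green_kernel (fun=> 0) z) = green_kernel G.
  by apply/funext => z; rewrite /green_kernel mul0mx addr0.
move=> hK ->; split=> //.
have -> : mx_integral P (fun=> 0) = 0 :> 'M[R]_n.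
  by apply/matrixP => i j; rewrite !mxE; exact: Rintegral_cstP.
by rewrite mul0mx addr0.
Qed.

(* With M the mean of K, the witness is [Y = E_w' K(., w') M^+], so that [Y D]
   stands for E_w' K(., w') M^(-1/2); that [Y D] is subgreen is the Schur
   complement bound of [kernel_block_ge0]. *)
Lemma kernel_root K : random_kernel A K ->
  let D := sqrt_mx (kernel_hat P K) in
  exists2 Y : T -> 'M[R]_n,
    subgreen (fun w => Y w *m D) /\ mx_integral P (fun w => Y w *m D) = D &
    forall w, Y w *m D *m D = kernel_mean P K w.
Proof.
move=> hK D; set M := kernel_hat P K in D *.
have pM : spd_mx M := kernel_hat_spd IA hK.
have sD : D^T = D := spd_sym (spd_sqrt pM).
have DD : D *m D = M := sqrt_mxK pM.
have [If Ef] := kernel_mean_fubini IA hK.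
(* If M u = 0, the block inequality is affine in the multiple of u, so its slope vanishes: the
   kernel of M lies in that of [kernel_mean]. *)
have fM w : (kernel_mean P K w <= M)%MS.
  apply: submx_of_ker => V MV0; apply/matrixP => i j; rewrite [RHS]mxE.
  rewrite -qform_delta qform_mul; set v := delta_mx i 0; set u := V *m _.
  have Mu : qform M u u = 0 by rewrite -qform_mul MV0 /qform mulmx0 mul0mx mxE.
  have block t : 0 <= t * qform (kernel_mean P K w) v u + qform (A w) v v.
    have := kernel_block_ge0 IA hK w ((t / 2) *: u) v.
    by rewrite !(qformZl, qformZr) Mu; lra.
  apply/le_anti/andP; split; last by apply: affine_nat_ge0 => k; exact: block.
  rewrite -oppr_ge0; apply: (@affine_nat_ge0 _ _ (qform (A w) v v)) => k.
  by have := block (- k.+1%:R); rewrite mulNr mulrN.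
pose Y w := kernel_mean P K w *m pinvmx M.
have YM w : Y w *m M = kernel_mean P K w by exact: mulmxKpV.
exists Y => [|w]; last by rewrite -mulmxA DD.
split; last first.
  (* The mean is M M^+ D, and M M^+ D D = M = D D; one factor D cancels because D is symmetric. *)
  rewrite mx_integral_mulr; last exact: mx_integrable_mulr.
  rewrite mx_integral_mulr// Ef; apply/eqP; rewrite -subr_eq0.
  rewrite -[X in _ - X]mul1mx -mulmxBl; apply/eqP/mulmx_sqr_cancel => //.
  by rewrite -mulmxA DD mulmxBl mul1mx mulmxKpV// subrr.
split=> [|w].
  apply: mx_integrable_measurable; apply: mx_integrable_mulr.
  exact: mx_integrable_mulr.
have [_ pA] := hA.
have -> : Y w *m D *m (Y w *m D)^T = Y w *m M *m (Y w)^T.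
  by rewrite trmx_mul sD !mulmxA -(mulmxA _ D D) DD.
split=> [|v].
  by rewrite linearB /= (spd_sym (pA w)) (spd_sym (spd_conjT _ pM)).
rewrite -/(qform _ _ _) qformBm.
(* The vector u = - Y^T v minimizes the block form and leaves the Schur complement A - Y M Y^T. *)
have := kernel_block_ge0 IA hK w (- 1 *: ((Y w)^T *m v)) v.
rewrite !(qformZl, qformZr) -qform_mul -YM.
by rewrite -qform_conj trmxK; lra.
Qed.

End Greens.

(** * Optimal kernels, optimal Green's matrices and barycenters *)

Section Optimality.
Context {R : realType} {n : nat} {d : measure_display} {T : measurableType d}.
Variables (P : probability T R) (A : T -> 'M[R]_n).
Hypotheses (hA : random_covariance A) (IA : mx_integrable P A).
Implicit Types (G H S : T -> 'M[R]_n) (K L : T * T -> 'M[R]_n).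

Lemma trace_norm_hat K : random_kernel A K ->
  trace_norm (kernel_hat P K) = \tr (kernel_hat P K).
Proof. by move=> /(kernel_hat_spd IA); exact: trace_norm_spd. Qed.

Lemma kernel_root_frob K : random_kernel A K ->
  let D := sqrt_mx (kernel_hat P K) in frob D D = \tr (kernel_hat P K).
Proof.
move=> hK D; have pM := kernel_hat_spd IA hK.
by rewrite /frob (spd_sym (spd_sqrt pM)) sqrt_mxK.
Qed.

Lemma measurable_conj (D : 'M[R]_n) : measurable_mx (fun w => D *m A w *m D).
Proof.
have [mA _] := hA; apply: measurable_mxM (measurable_mx_cst _).
exact: measurable_mxM (measurable_mx_cst _) mA.
Qed.

(** Conjugating G G^T <= A by D gives (D G) (D G)^T <= D A D, to which [tr_le_of_gram] applies. *)
Lemma subgreen_tr_le (D : 'M[R]_n) G w : spd_mx D -> subgreen A G ->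
  frob D (G w) <= \tr (sqrt_mx (D *m A w *m D)).
Proof.
move=> pD [_ sG]; have sD := spd_sym pD; have [_ pA] := hA.
have pN := spd_conj_sym sD (pA w).
rewrite /frob sD; apply: tr_le_of_gram; first exact: spd_sqrt.
rewrite sqrt_mxK// trmx_mul sD mulmxA -(mulmxA D (G w)) -mulmxBl -mulmxBr.
exact: spd_conj_sym.
Qed.

(* For invertible [D], the matrix [S = D^-1 (D A D)^(1/2)] satisfies [S S^T = A]
   and maximizes [frob D S]; a singular [D] is perturbed to [D + e 1]. *)
Lemma kernel_le_optimal_green G L : optimal_green P A G -> random_kernel A L ->
  \tr (kernel_hat P L) <= frob (mx_integral P G) (mx_integral P G).
Proof.
move=> [_ optG] hL; have pM := kernel_hat_spd IA hL; have [mA pA] := hA.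
have := kernel_root_frob hL; have := kernel_root hA IA hL.
set D := sqrt_mx _ => -[Y [sG0 EG0] _] <-; pose G0 w := Y w *m D.
have pD : spd_mx D by exact: spd_sqrt.
set g := frob (mx_integral P G) _.
(* In total 2 <De, D> <= 2 <De, E S> <= |De|^2 + |E S|^2; on expansion the terms linear in e cancel,
   which leaves the error e^2 n. *)
have bound (e : R) : 0 < e -> frob D D <= g + e ^+ 2 * n%:R.
  move=> e0; pose De := D + e%:M.
  have pDe : spd_mx De.
    by rewrite /De -scalemx1; apply: spdD => //; apply: spdZ (ltW e0) (spd1).
  have sDe := spd_sym pDe.
  have uDe : De \in unitmx by exact: spd_add_scalar_unit.
  pose N w := sqrt_mx (De *m A w *m De); pose S w := invmx De *m N w.
  have pDAD w : spd_mx (De *m A w *m De) by exact: spd_conj_sym.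
  have mS : measurable_mx S.
    apply: measurable_mxM; first exact: measurable_mx_cst.
    exact: measurable_sqrt_mx (measurable_conj De) pDAD.
  have SA w : S w *m (S w)^T = A w.
    rewrite trmx_mul (spd_sym (spd_sqrt (pDAD w))) trmx_inv sDe.
    rewrite mulmxA -(mulmxA (invmx De)) sqrt_mxK// !mulmxA mulVmx// mul1mx.
    by rewrite mulmxK.
  have sS := exact_subgreen mS SA.
  have IS := subgreen_integrable IA sS; have IG0 := subgreen_integrable IA sG0.
  have le1 : frob De D <= frob De (mx_integral P S).
    rewrite -[X in frob De X <= _]EG0 -!Rintegral_frob//; apply: le_Rintegral => //.
    - exact: Rintegrable_frob.
    - exact: Rintegrable_frob.
    - move=> w _; apply: le_trans (subgreen_tr_le w pDe sG0) _.
      by rewrite /frob sDe mulKVmx.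
  have le2 : frob (mx_integral P S) (mx_integral P S) <= g.
    rewrite -le_hs_norm; apply: optG; split=> //.
    exact: aeW.
  have := frob_amgm De (mx_integral P S); move: le1.
  rewrite /De -scalemx1 !(frobDl, frobDr, frobZl, frobZr) (frobC D 1%:M).
  have -> : frob (1%:M : 'M[R]_n) 1%:M = n%:R.
    by rewrite /frob trmx1 mul1mx mxtrace1.
  by rewrite expr2; lra.
(* Take e = 1 / (k + 1) and multiply by k + 1: the error stays below n. *)
rewrite -subr_ge0; apply: (@affine_nat_ge0 _ _ n%:R) => k.
have k0 : 0 < k.+1%:R :> R by [].
have := bound k.+1%:R^-1; rewrite invr_gt0 => /(_ k0).
rewrite -(ler_pM2l k0) mulrDr expr2 !mulrA mulfV ?gt_eqF// mul1r.
have : k.+1%:R^-1 * n%:R <= n%:R :> R.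
  by rewrite ler_piMl// invf_le1// ler1n.
rewrite mulrBr; move: (_^-1 * _) (_ * g) (_ * frob D D) => x y z; lra.
Qed.

(** Averaging the sections over w identifies the mean of K with E G (E G)^T, whose trace |E G|^2
    bounds all kernels by [kernel_le_optimal_green]. *)
Lemma green_mean_optimal G K : optimal_green P A G -> random_kernel A K ->
    {ae P, forall w, mx_integral P (fun w' => K (w, w')) =
                     mx_integral P (fun w' => G w *m (G w')^T)} ->
  optimal_kernel P A K.
Proof.
move=> oG hK KG; have [hG _] := oG; have [mG _] := hG.
have [If Ef] := kernel_mean_fubini IA hK.
have EK : kernel_hat P K = mx_integral P G *m (mx_integral P G)^T.
  have [G' [mG' G'A _ GG']] := green_correct hA hG.
  rewrite -Ef (mx_integral_ae mG mG' GG') -mx_integral_mulr; last first.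
    exact/(subgreen_integrable IA)/exact_subgreen.
  apply: mx_integral_ae.
  - exact: mx_integrable_measurable.
  - exact: measurable_mxM mG' (measurable_mx_cst _).
  - move: KG (GG'); apply: filterS2 => w; rewrite /kernel_mean => -> eqG.
    by rewrite (green_section_mean hA IA)// eqG (mx_integral_ae mG mG' GG').
split=> // L hL; rewrite !trace_norm_hat// EK -frob_trE.
exact: kernel_le_optimal_green.
Qed.

Lemma optimal_kernel_subgreen K S : optimal_kernel P A K -> subgreen A S ->
  frob (mx_integral P S) (mx_integral P S) <= \tr (kernel_hat P K).
Proof.
move=> [hK optK] /(subgreen_kernel hA IA)[L hL] /le_trans; apply.
by rewrite -!trace_norm_hat// optK.
Qed.

(** The tilted family S t is subgreen, so |E S t| <= |D| and <D, E S t> <= |D|^2. Expanded, this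
    bounds the first-order gain t E(c tau) by t^2 |D|^2, which forces E(c tau) = 0; and tau is the
    squared norm of the matrix in the conclusion. *)
Lemma optimal_kernel_defect K (D := sqrt_mx (kernel_hat P K)) G :
    optimal_kernel P A K -> subgreen A G -> mx_integral P G = D ->
  {ae P, forall w, sqrt_mx (A w - G w *m (G w)^T) *m D = 0}.
Proof.
move=> oK sG EG; have [hK _] := oK; have [mA pA] := hA; have [mG pQ] := sG.
have pM := kernel_hat_spd IA hK; have sD : D^T = D := spd_sym (spd_sqrt pM).
pose Q w := A w - G w *m (G w)^T; pose tau w := \tr (D^T *m Q w *m D).
have tau0 w : 0 <= tau w by exact/spd_tr_ge0/spd_conj/pQ.
(* This weight is positive and satisfies n c^2 tau <= 1, as [subgreen_tilt] requires. *)
pose c w := (1 + n%:R * tau w)^-1.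
have u0 w : 0 < 1 + n%:R * tau w by rewrite ltr_wpDr// mulr_ge0.
have c0 w : 0 < c w by rewrite invr_gt0.
pose S (t : R) w := (1 + t ^+ 2)^-1 *: (G w + (t * c w) *: (Q w *m D)).
have mQ : measurable_mx Q.
  exact: measurable_mxB mA (measurable_mxM mG (measurable_trmx mG)).
have mQD : measurable_mx (fun w => Q w *m D).
  exact: measurable_mxM mQ (measurable_mx_cst _).
have mtau : measurable_fun setT tau.
  apply: measurable_mxtrace; under eq_fun do rewrite -mulmxA.
  exact: measurable_mxM (measurable_mx_cst _) mQD.
have mc : measurable_fun setT c.
  apply/measurable_invr/measurable_funD; first exact: measurable_cst.
  by apply: measurable_funM => //; exact: measurable_cst.
have sS t : subgreen A (S t).
  split=> [|w].
    apply: measurable_mxZ; first exact: measurable_cst.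
    apply: measurable_mxD => //; apply: measurable_mxZ => //.
    by apply: measurable_funM => //; exact: measurable_cst.
  apply: subgreen_tilt => //; rewrite -/(Q w) -/(tau w) mulrCA -/(Q w).
  rewrite /c exprVn ler_pdivrMl ?exprn_gt0// mulr1.
  have : 0 <= n%:R * tau w by rewrite mulr_ge0.
  by rewrite expr2; nra.
have IG := subgreen_integrable IA sG.
have FS t w : (1 + t ^+ 2) * frob D (S t w) = frob D (G w) + t * (c w * tau w).
  rewrite /S frobZr frobDr frobZr mulrA mulfV ?mul1r; last first.
    by rewrite gt_eqF// ltr_wpDr// sqr_ge0.
  by rewrite /frob /tau mulmxA mulrA.
(* Integrability is read off from [FS] at t = 1. *)
have Ict : Rintegrable P (fun w => c w * tau w).
  have -> : (fun w => c w * tau w) =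
      fun w => 2 * frob D (S 1 w) + (- 1) * frob D (G w).
    by apply/funext => w; have := FS 1 w; rewrite expr1n mul1r; lra.
  apply: RintegrableD; apply: RintegrableZ; apply: Rintegrable_frob => //.
  exact: subgreen_integrable.
have FD : frob D D = \tr (kernel_hat P K) by exact: kernel_root_frob.
have ct_le t : t * \int[P]_w (c w * tau w) <= t ^+ 2 * frob D D.
  have IS := subgreen_integrable IA (sS t).
  have IFS := Rintegrable_frob D IS; have IFG := Rintegrable_frob D IG.
  have : \int[P]_w ((1 + t ^+ 2) * frob D (S t w)) =
         \int[P]_w (frob D (G w) + t * (c w * tau w)).
    by apply: eq_Rintegral => w _; exact: FS.
  rewrite (RintegralZl _ measurableT IFS).
  rewrite (RintegralD measurableT IFG (RintegrableZ t Ict)).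
  rewrite (RintegralZl _ measurableT Ict) !Rintegral_frob// EG => eqt.
  have := optimal_kernel_subgreen oK (sS t); rewrite -FD => leS.
  have := frob_amgm D (mx_integral P (S t)) => amgm.
  have u : 0 < 1 + t ^+ 2 by rewrite ltr_wpDr// sqr_ge0.
  have : (1 + t ^+ 2) * frob D (mx_integral P (S t)) <= (1 + t ^+ 2) * frob D D.
    by rewrite ler_pM2l//; lra.
  by rewrite eqt; lra.
have ct0 : \int[P]_w (c w * tau w) = 0.
  apply/le_anti/andP; split; last first.
    by apply: Rintegral_ge0 => w _; rewrite mulr_ge0// ltW.
  (* Take t = 1 / (k + 1) and multiply by (k + 1)^2. *)
  rewrite -oppr_ge0; apply: (@affine_nat_ge0 _ _ (frob D D)) => k.
  have k0 : 0 < k.+1%:R :> R by [].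
  have := ct_le k.+1%:R^-1.
  rewrite -(ler_pM2l (exprn_gt0 2 k0)) mulrA expr2 -(mulrA k.+1%:R).
  rewrite mulfV ?gt_eqF// mulr1 [X in _ <= X]mulrA -expr2 -exprMn.
  by rewrite mulfV ?gt_eqF// expr1n mul1r mulrN; lra.
have : {ae P, forall w, c w * tau w = 0}.
  pose ct w : \bar R := (c w * tau w)%:E.
  have mct : measurable_fun setT ct by apply: (measurable_int P); exact: Ict.
  have int0 : (\int[P]_w `|ct w| = 0)%E.
    rewrite (eq_integral ct) => [|w _].
      by rewrite -[LHS]fineK ?(integrable_fin_num measurableT Ict)//; congr EFin.
    by rewrite /ct /= ger0_norm// mulr_ge0// ltW.
  have := (ae_eq_integral_abs P measurableT mct).1 int0.
  by apply: filterS => w /(_ Logic.I) [].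
apply: filterS => w /eqP; rewrite mulf_eq0 gt_eqF//= => /eqP tw0.
apply: frob_eq0; rewrite /frob trmx_mul (spd_sym (spd_sqrt (pQ w))).
by rewrite -mulmxA (mulmxA (sqrt_mx _)) sqrt_mxK// mulmxA.
Qed.

Lemma optimal_kernel_green K : optimal_kernel P A K ->
  exists G, optimal_green P A G /\
    {ae P, forall w, mx_integral P (fun w' => K (w, w')) =
                     mx_integral P (fun w' => G w *m (G w')^T)}.
Proof.
move=> oK; have [hK _] := oK; have [mA pA] := hA.
have FD := kernel_root_frob hK; have := kernel_root hA IA hK.
set D := sqrt_mx (kernel_hat P K) in FD * => -[Y [sG0 EG0] YDD].
have pM := kernel_hat_spd IA hK; have sD : D^T = D := spd_sym (spd_sqrt pM).
pose G0 w := Y w *m D; have [mG0 pQ] := sG0.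
pose h w := sqrt_mx (A w - G0 w *m (G0 w)^T).
have mh : measurable_mx h.
  apply: measurable_sqrt_mx => //.
  exact: measurable_mxB mA (measurable_mxM mG0 (measurable_trmx mG0)).
have sh w : (h w)^T = h w := spd_sym (spd_sqrt (pQ w)).
have hD : {ae P, forall w, h w *m D = 0} by exact: optimal_kernel_defect.
pose G w := G0 w + h w.
have mG : measurable_mx G by exact: measurable_mxD.
(* The cross terms of (G0 + h) (G0 + h)^T vanish since h D = 0 and G0 ends in the factor D. *)
have hG : random_green P A G.
  split=> //; move: hD; apply: filterS => w hDw.
  have Dh : D *m h w = 0 by rewrite -sD -(sh w) -trmx_mul hDw trmx0.
  have G0h : G0 w *m h w = 0 by rewrite -mulmxA Dh mulmx0.
  have hG0 : h w *m (G0 w)^T = 0 by rewrite -(sh w) -trmx_mul G0h trmx0.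
  rewrite /G linearD /= mulmxDl !mulmxDr sh G0h hG0 addr0 add0r.
  by rewrite (sqrt_mxK (pQ w)) addrC subrK.
have Ih : mx_integrable P h.
  apply: (subgreen_integrable IA); split=> // w.
  by rewrite sh (sqrt_mxK (pQ w)) opprB addrC subrK; exact: spd_gram.
have IG0 := subgreen_integrable IA sG0.
have EG : mx_integral P G = D + mx_integral P h by rewrite mx_integralD// EG0.
have maxK S : random_green P A S ->
    frob (mx_integral P S) (mx_integral P S) <= frob D D.
  move=> hS; have [S' [mS' S'A _ SS']] := green_correct hA hS.
  have [mS _] := hS; rewrite (mx_integral_ae mS mS' SS') FD.
  exact/(optimal_kernel_subgreen oK)/exact_subgreen.
have DEh : frob D (mx_integral P h) = 0.
  rewrite -Rintegral_frob// -(Rintegral_cstP P 0); apply: Rintegral_ae.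
  - exact: Rintegrable_measurable (Rintegrable_frob D Ih).
  - exact: measurable_cst.
  - move: hD; apply: filterS => w hDw.
    by rewrite frob_trE sh -[D]sD -(sh w) -trmx_mul hDw trmx0 mxtrace0.
(* By orthogonality |D + E h|^2 = |D|^2 + |E h|^2, while optimality bounds the left side by
   |D|^2. *)
have Eh : mx_integral P h = 0.
  apply: frob_eq0; apply/le_anti; rewrite frob_ge0 andbT.
  have := maxK G hG; rewrite EG !(frobDl, frobDr) (frobC _ D) DEh; lra.
have {}EG : mx_integral P G = D by rewrite EG Eh addr0.
exists G; split.
  by split=> // S hS; rewrite le_hs_norm EG; exact: maxK.
(* G w D = Y w D D because h w D = 0, and this is the mean of the section of K at w. *)
move: hD; apply: filterS => w hDw.
rewrite (green_section_mean hA IA)// EG sD /G mulmxDl hDw addr0.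
exact/esym/YDD.
Qed.

(** For N = (D A D)^(1/2), AM-GM against the identity gives 2 tr N <= n + tr N^2, and N^2 = D A D is
    integrable. *)
Lemma Rintegrable_tr_sqrt (D : 'M[R]_n) : spd_mx D ->
  Rintegrable P (fun w => \tr (sqrt_mx (D *m A w *m D))).
Proof.
move=> pD; have [_ pA] := hA.
have pN w := spd_conj_sym (spd_sym pD) (pA w).
apply: (Rintegrable_le (g := fun w => n%:R + \tr (D *m A w *m D))).
- exact/measurable_mxtrace/(measurable_sqrt_mx (measurable_conj D)).
- apply: RintegrableD; first exact: Rintegrable_cst.
  exact/Rintegrable_mxtrace/mx_integrable_mulr/mx_integrable_mull.
- move=> w; have pS := spd_sqrt (pN w).
  have := frob_amgm 1%:M (sqrt_mx (D *m A w *m D)).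
  rewrite [frob (sqrt_mx _) _]/frob (spd_sym pS) sqrt_mxK//.
  rewrite /frob trmx1 !mul1mx mxtrace1 ger0_norm ?spd_tr_ge0//.
  have := spd_tr_ge0 (pN w); have := spd_tr_ge0 pS.
  have : (0 : R) <= n%:R by [].
  lra.
Qed.

(** With the argument written as D^2, its square root inside [wasserstein2] is D itself. *)
Lemma expectation_wasserstein2 (D : 'M[R]_n) : spd_mx D ->
  ('E_P[fun w => wasserstein2 (D *m D) (A w)] =
   (frob D D + \tr (mx_integral P A) -
    2 * \int[P]_w \tr (sqrt_mx (D *m A w *m D)))%:E)%E.
Proof.
move=> pD; pose N w := \tr (sqrt_mx (D *m A w *m D)).
have IN : Rintegrable P N by exact: Rintegrable_tr_sqrt.
have ItA := Rintegrable_mxtrace IA.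
have Ic := Rintegrable_cst P (frob D D).
have I1 := RintegrableD Ic ItA; have I2 := RintegrableZ (- 2) IN.
have -> : (fun w => wasserstein2 (D *m D) (A w)) =
    fun w => frob D D + \tr (A w) + (- 2) * N w.
  apply/funext => w; rewrite /wasserstein2 sqrt_mx_sqr// /frob (spd_sym pD).
  by rewrite -/(N w) mulNr.
rewrite unlock -[LHS]fineK; last first.
  exact: (integrable_fin_num measurableT (RintegrableD I1 I2)).
congr EFin; rewrite -[LHS]/(\int[P]_w (frob D D + \tr (A w) + (- 2) * N w)).
rewrite (RintegralD measurableT I1 I2) (RintegralD measurableT Ic ItA).
rewrite (RintegralZl _ measurableT IN) Rintegral_cstP mulNr.
by rewrite (Rintegral_mxtrace IA).
Qed.

Lemma subgreen_maximizer (D : 'M[R]_n) : spd_mx D ->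
  exists2 G, subgreen A G &
    forall w, frob D (G w) = \tr (sqrt_mx (D *m A w *m D)).
Proof.
move=> pD; have sD := spd_sym pD; have [mA pA] := hA.
have pDAD w := spd_conj_sym sD (pA w).
pose N w := sqrt_mx (D *m A w *m D).
have pN w : spd_mx (N w) := spd_sqrt (pDAD w).
have NN w : N w *m N w = D *m A w *m D := sqrt_mxK (pDAD w).
have [Y YE] := choice (fun w => solve_conj (pA w) sD).
have gram w := solve_conj_gram (pA w) sD (pN w) (NN w) (YE w).
exists (fun w => Y w *m N w); last by move=> w; rewrite /frob sD (gram w).1.
split; last by move=> w; exact: (gram w).2.
(* Y comes from choice and need not be measurable; F avoids it, and converges to Y w N w because Y w
   (N w)^2 = A w D. *)
pose F k w := A w *m D *m invmx (N w + (k.+1%:R^-1)%:M).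
apply: (measurable_mx_lim (F := F)) => [k|w].
  apply: measurable_mxM; first exact: measurable_mxM mA (measurable_mx_cst _).
  apply: measurable_invmx => [|w].
    apply: measurable_mxD; last exact: measurable_mx_cst.
    exact: measurable_sqrt_mx (measurable_conj D) pDAD.
  by apply: spd_add_scalar_unit; rewrite // invr_gt0.
by have := @resolvent_cvg _ _ _ (Y w) (pN w); rewrite NN YE.
Qed.

(** Let C^2 be the mean of L. Minimality gives |D|^2 - 2 <D, E G0> <= |C|^2 - 2 E tr (C A C)^(1/2)
    <= - |C|^2, hence |C|^2 <= 2 <D, E G0> - |D|^2 <= |E G0|^2, which is at most the trace of the
    mean of K. *)
Lemma barycenter_optimal_kernel B : barycenter P A B ->
  exists K, optimal_kernel P A K.
Proof.
move=> [pB minB]; pose D := sqrt_mx B; have pD : spd_mx D := spd_sqrt pB.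
have [G0 sG0 DG0] := subgreen_maximizer pD.
have [K hK leK] := subgreen_kernel hA IA sG0.
exists K; split=> // L hL; rewrite !trace_norm_hat//; apply: le_trans leK.
have pL := kernel_hat_spd IA hL; pose C := sqrt_mx (kernel_hat P L).
have pC : spd_mx C := spd_sqrt pL.
have FC : frob C C = \tr (kernel_hat P L) := kernel_root_frob hL.
have [Y [sG EG] _] := kernel_root hA IA hL; rewrite -/C in sG EG.
have := minB _ pL; rewrite -[in X in X -> _](sqrt_mxK pB).
rewrite -[in X in X -> _](sqrt_mxK pL) -/D -/C.
rewrite !expectation_wasserstein2// lee_fin => le.
have leC : frob C C <= \int[P]_w \tr (sqrt_mx (C *m A w *m C)).
  rewrite -[X in frob C X <= _]EG -Rintegral_frob; last exact: subgreen_integrable.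
  apply: le_Rintegral => //.
  - exact/Rintegrable_frob/(subgreen_integrable IA).
  - exact: Rintegrable_tr_sqrt.
  - by move=> w _; exact: (subgreen_tr_le w pC sG).
have eqD : frob D (mx_integral P G0) = \int[P]_w \tr (sqrt_mx (D *m A w *m D)).
  rewrite -Rintegral_frob; last exact: subgreen_integrable.
  by apply: eq_Rintegral => w _; exact: DG0.
by have := frob_amgm D (mx_integral P G0); rewrite -FC; lra.
Qed.

End Optimality.

Theorem theorem4p6 (R : realType) (n : nat) (d : measure_display)
    (T : measurableType d) (P : probability T R) (A : T -> 'M[R]_n)
    (hA : random_covariance A)
    (hAint : ('E_P[fun w => trace_norm (A w)] < +oo)%E) :
  [/\ forall K : T * T -> 'M[R]_n, random_kernel A K ->
        (optimal_kernel P A K <->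
         exists G : T -> 'M[R]_n, optimal_green P A G /\
           {ae P, forall w, mx_integral P (fun w' => K (w, w')) =
                            mx_integral P (fun w' => G w *m (G w')^T)}),
      ~ (exists G : T -> 'M[R]_n, optimal_green P A G) ->
        ~ (exists B : 'M[R]_n, barycenter P A B)
    & forall G : T -> 'M[R]_n, optimal_green P A G ->
        exists G' : T -> 'M[R]_n,
          [/\ optimal_green P A G',
              forall w, G w *m (G w)^T = A w -> G' w = G w
            & optimal_kernel P A (green_kernel G')]].
Proof.
have IA := covariance_integrable hA hAint.
split.
- move=> K hK; split; first exact: optimal_kernel_green.
  by move=> [G [oG KG]]; exact: green_mean_optimal oG hK KG.
- move=> noG [B /(barycenter_optimal_kernel hA IA)[K oK]]; apply: noG.
  by have [G [oG _]] := optimal_kernel_green hA IA oK; exists G.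
- move=> G oG; have [hG optG] := oG; have [mG _] := hG.
  (* The diagonal of [green_kernel G] may differ from A on a null set; the corrected G' has the same
     mean and hence stays optimal. *)
  have [G' [mG' G'A G'G GG']] := green_correct hA hG; exists G'.
  have oG' : optimal_green P A G'.
    split=> [|S hS]; first by split=> //; exact: aeW.
    by rewrite -(mx_integral_ae mG mG' GG'); exact: optG.
  split=> //; have [hK _] := exact_green_kernel IA mG' G'A.
  by apply: (green_mean_optimal hA IA oG' hK); exact: aeW.
Qed.
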